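(* Let $G$ be a finite group and $n\ge0$. There is a pullback diagram of commutative rings \[\begin{array}{ccc}\mathring{A}(G,n)&\longrightarrow&A(G\wr\Sigma_n)\\ {\scriptstyle\chi}\downarrow&&\downarrow{\scriptstyle\chi}\\ \mathrm{Parks}(G,n)&\xrightarrow{\ \beta^*\ }&\mathrm{Marks}(G\wr\Sigma_n)\end{array}\] where the top map is the inclusion, the left map is the parks homomorphism, the right map is the marks homomorphism, and $\beta^*$ is precomposition with $\beta\colon\mathrm{Conj}(G\wr\Sigma_n)\to\mathrm{Parts}(G,n)$. In particular, $\chi\colon\mathring{A}(G,n)\to\mathrm{Parks}(G,n)$ is a map of rings.
   Context: For a finite group $\Gamma$, $A(\Gamma)$ is the Burnside ring, with canonical $\mathbb{Z}$-basis the isomorphism classes of transitive $\Gamma$-sets; $\mathrm{Conj}(\Gamma)$ is the set of conjugacy classes of subgroups; $\mathrm{Marks}(\Gamma)$ is the ring of functions $\mathrm{Conj}(\Gamma)\to\mathbb{Z}$ under pointwise operations; the marks homomorphism $\chi\colon A(\Gamma)\to\mathrm{Marks}(\Gamma)$ is $\chi([X])([H])=|X^H|$. $G\wr\Sigma_n=G^{\times n}\rtimes\Sigma_n$ with $(\bar g,\sigma)(\bar h,\tau)=(\bar g\,\sigma\bar h,\sigma\tau)$, $(\sigma\bar h)_i=\bar h_{\sigma^{-1}(i)}$; for a left $G$-set $X$ it acts on $X^{\times n}$ by $((\bar g,\sigma)x)_i=\bar g_ix_{\sigma^{-1}(i)}$. The transfer product $\star\colon A(G\wr\Sigma_i)\otimes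 A(G\wr\Sigma_j)\to A(G\wr\Sigma_{i+j})$ is $X\star Y=(G\wr\Sigma_{i+j})\times_{G\wr\Sigma_i\times G\wr\Sigma_j}(X\times Y)$. The total power operations $\mathbb{P}_n\colon A(G)\to A(G\wr\Sigma_n)$ are the unique functions with $\mathbb{P}_n([X])=[X^{\times n}]$, $\mathbb{P}_0=1$ and $\mathbb{P}_n(x+y)=\sum_{i+j=n}\mathbb{P}_i(x)\star\mathbb{P}_j(y)$. $\mathring{A}(G,n)\subseteq A(G\wr\Sigma_n)$ is the summand spanned by the smallest subset of the canonical basis whose span contains the image of $\mathbb{P}_n$. It is a subring of $A(G\wr\Sigma_n)$, and $\mathring{A}(G)=\bigoplus_{n\ge0}\mathring{A}(G,n)$ is a commutative graded ring under $\star$, in fact a polynomial ring on the generators $\mathbb{P}_n([G/H])$ in degree $n$, for $n>0$ and $[H]\in\mathrm{Conj}(G)$. $\mathrm{Parts}(G)$ is the free commutative monoid on $\mathrm{Conj}(G)\times\mathbb{N}_{>0}$, whose elements are finitely supported functions $\lambda\colon\mathrm{Conj}(G)\times\mathbb{N}_{>0}\to\mathbb{N}$, written $\lambda=\sum\lambda_{[H],m}\cdot([H],m)$; $\|\lambda\|=\sum\lambda_{[H],m}m$, $\lambda!=\prod\lambda_{[H],m}!$, and $\mathrm{Parts}(G,n)=\{\lambda:\|\lambda\|=n\}$. $\mathrm{Parks}(G,n)$ is the ring of functions $\mathrm{Parts}(G,n)\to\mathbb{Z}$ under pointwise operations. $\mathrm{Parks}(G)=\bigoplus_n\mathrm{Parks}(G,n)$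 is a commutative graded ring under $(f\star g)(\mu)=\sum_{\kappa+\lambda=\mu}\frac{\mu!}{\kappa!\lambda!}f(\kappa)g(\lambda)$. The parks homomorphism $\chi\colon\mathring{A}(G)\to\mathrm{Parks}(G)$ is the unique homomorphism of graded rings (for the $\star$-products) such that $\chi(\mathbb{P}_n(x))(\lambda)=\prod_{[H],m}\chi(x)([H])^{\lambda_{[H],m}}$ for all $x\in A(G)$, $n\ge0$, $\lambda\in\mathrm{Parts}(G,n)$; here $\chi(x)$ is the mark of $x$. Its degree $n$ component is $\chi\colon\mathring{A}(G,n)\to\mathrm{Parks}(G,n)$. For a subgroup $H\subseteq G\wr\Sigma_n$, let $H$ act on $[n]=\{1,\dots,n\}$ through $G\wr\Sigma_n\to\Sigma_n$, let $H\backslash[n]$ be the set of orbits $Hi$, and let $H_{ii}=\{\bar g_i\mid(\bar g,\sigma)\in H,\ \sigma(i)=i\}\subseteq G$. Then $\beta([H])=\sum_{Hi\in H\backslash[n]}([H_{ii}],|Hi|)\in\mathrm{Parts}(G,n)$, which is well defined, and $\beta^*f([H])=f(\beta([H]))$. *)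

(* Defs.v *)
From HB Require Import structures.
From mathcomp Require Import all_boot all_order all_fingroup all_algebra.
From mathcomp Require Import finmap multiset.
From mathcomp Require Import boolp.

Set Implicit Arguments.
Unset Strict Implicit.
Unset Printing Implicit Defensive.

Import GroupScope GRing.Theory.
Local Open Scope group_scope.
Local Open Scope ring_scope.

(* The finite group Gamma is the whole type gT; conj_class is Conj(Gamma). *)

Section ConjClass.
Variable gT : finGroupType.

Definition conj_class :=
  {C : {set {group gT}} | C \in orbit 'JG [set: gT] @: [set: {group gT}]}.
HB.instance Definition _ := Finite.on conj_class.

Definition class_of (H : {group gT}) : conj_class :=
  Sub (orbit 'JG [set: gT] H) (imset_f _ (in_setT H)).

Definition class_rep (C : conj_class) : {group gT} :=
  odflt 1%G [pick H in val C].

Lemma class_ofP (H K : {group gT}) :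
  reflect (exists a, K :=: H :^ a) (class_of H == class_of K).
Proof.
rewrite -val_eqE /= eq_sym; apply: (iffP idP) => [|[a Ka]].
  rewrite orbit_eq_mem => /orbitP[a _ <-]; by exists a.
by rewrite orbit_eq_mem; apply/orbitP; exists a => //; apply/val_inj.
Qed.

Lemma class_repK : cancel class_rep class_of.
Proof.
move=> C; apply/val_inj => /=; rewrite /class_rep.
have /imsetP[H _ CH] := valP C.
case: pickP => [K | /(_ H)]; last by rewrite CH orbit_refl.
by rewrite /= CH -orbit_eq_mem => /eqP ->.
Qed.

End ConjClass.

Record gset (gT : finGroupType) := GSet {
  gset_sort :> finType;
  gact : gT -> gset_sort -> gset_sort;
  gact1 : forall x, gact 1%g x = x;
  gactM : forall a b x, gact (a * b)%g x = gact a (gact b x)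
}.
Arguments gact {gT} g.

Section GSetTheory.
Variable gT : finGroupType.

(* MathComp actions are right actions; a left action is the right action of
   the inverses, with the same orbits, stabilisers and fixed points. *)
Section RightAction.
Variable X : gset gT.
Definition rfun (x : X) (a : gT) : X := gact X a^-1%g x.
Fact rfun1 : rfun^~ 1%g =1 id.
Proof. by move=> x; rewrite /rfun invg1 gact1. Qed.
Fact rfunM x : act_morph rfun x.
Proof. by move=> a b; rewrite /rfun invMg gactM. Qed.
Definition ract : {action gT &-> X} := TotalAction rfun1 rfunM.
End RightAction.

Definition gorbits (X : gset gT) : {set {set X}} :=
  orbit (ract X) [set: gT] @: [set: X].

Section Cosets.
Variable H : {group gT}.
Definition lcoset_sort := {A : {set gT} | A \in lcosets H [set: gT]}.
HB.instance Definition _ := Finite.on lcoset_sort.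
Fact lcoset_act_subproof (a : gT) (A : lcoset_sort) :
  (a *: val A)%g \in lcosets H [set: gT].
Proof.
have /lcosetsP[b _ ->] := valP A.
by apply/lcosetsP; exists (a * b)%g; rewrite ?inE // lcosetM.
Qed.
Definition lcoset_act a (A : lcoset_sort) : lcoset_sort :=
  Sub (a *: val A)%g (lcoset_act_subproof a A).
Fact lcoset_act1 A : lcoset_act 1%g A = A.
Proof. by apply/val_inj; rewrite /= lcoset1. Qed.
Fact lcoset_actM a b A : lcoset_act (a * b)%g A = lcoset_act a (lcoset_act b A).
Proof. by apply/val_inj; rewrite /= lcosetM. Qed.
Definition coset_gset : gset gT := GSet lcoset_act1 lcoset_actM.
End Cosets.

Definition point_gset : gset gT :=
  @GSet gT unit (fun _ x => x) (fun _ => erefl) (fun _ _ _ => erefl).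

Section Prod.
Variables X Y : gset gT.
Definition prod_act a (p : X * Y) := (gact X a p.1, gact Y a p.2).
Fact prod_act1 p : prod_act 1%g p = p.
Proof. by case: p => x y; rewrite /prod_act !gact1. Qed.
Fact prod_actM a b p : prod_act (a * b)%g p = prod_act a (prod_act b p).
Proof. by rewrite /prod_act !gactM. Qed.
Definition prod_gset : gset gT := GSet prod_act1 prod_actM.
End Prod.

End GSetTheory.

Section ExtProd.
Variables (gT1 gT2 : finGroupType) (X : gset gT1) (Y : gset gT2).
Definition extprod_act (a : gT1 * gT2) (p : X * Y) :=
  (gact X a.1 p.1, gact Y a.2 p.2).
Fact extprod_act1 p : extprod_act 1%g p = p.
Proof. by case: p => x y; rewrite /extprod_act /= !gact1. Qed.
Fact extprod_actM a b p :
  extprod_act (a * b)%g p = extprod_act a (extprod_act b p).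
Proof. by rewrite /extprod_act !gactM. Qed.
Definition extprod_gset : gset (gT1 * gT2)%type :=
  GSet extprod_act1 extprod_actM.
End ExtProd.

(* The induced set gT x_kT Z along f : kT -> gT. *)
Section Induction.
Variables (kT gT : finGroupType) (f : {morphism [set: kT] >-> gT}) (Z : gset kT).

Definition balanced_act (k : kT) (p : gT * Z) : gT * Z :=
  ((p.1 * (f k)^-1)%g, gact Z k p.2).
Fact balanced_act1 p : balanced_act 1%g p = p.
Proof. by case: p => g z; rewrite /balanced_act morph1 invg1 mulg1 gact1. Qed.
Fact balanced_actM a b p :
  balanced_act (a * b)%g p = balanced_act a (balanced_act b p).
Proof. by rewrite /balanced_act morphM ?inE // invMg mulgA gactM. Qed.
Definition balanced_gset : gset kT := GSet balanced_act1 balanced_actM.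

Definition ind_sort := {O : {set gT * Z} | O \in gorbits balanced_gset}.
HB.instance Definition _ := Finite.on ind_sort.

Fact ind_act_subproof (a : gT) (O : ind_sort) :
  [set ((a * p.1)%g, p.2) | p in val O] \in gorbits balanced_gset.
Proof.
have /imsetP[[g z] _ ->] := valP O.
apply/imsetP; exists ((a * g)%g, z) => //.
apply/setP=> -[h y]; apply/imsetP/orbitP => [[p /orbitP[k _ <-]]|[k _ /= E]].
  by move=> ->; exists k; rewrite ?inE //= /rfun /balanced_act /= mulgA.
exists (ract balanced_gset (g, z) k); first by apply/orbitP; exists k.
by rewrite -E /= /rfun /= /balanced_act /= mulgA.
Qed.
Definition ind_act a (O : ind_sort) : ind_sort :=
  Sub [set ((a * p.1)%g, p.2) | p in val O] (ind_act_subproof a O).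
Fact ind_act1 O : ind_act 1%g O = O.
Proof.
apply/val_inj => /=; rewrite -[RHS]imset_id.
by apply: eq_imset => -[g z]; rewrite /= mul1g.
Qed.
Fact ind_actM a b O : ind_act (a * b)%g O = ind_act a (ind_act b O).
Proof.
apply/val_inj => /=; rewrite -imset_comp.
by apply: eq_imset => -[g z]; rewrite /= mulgA.
Qed.
Definition ind_gset : gset gT := GSet ind_act1 ind_actM.

End Induction.

Definition marks (gT : finGroupType) := {ffun conj_class gT -> int}.
HB.instance Definition _ gT := GRing.Zmodule.on (marks gT).
HB.instance Definition _ gT := GRing.Zmodule_isComPzRing.Build (marks gT)
  (@ffun_mulA _ _) (@ffun_mulC _ _) (@ffun_mul_1l _ _) (@ffun_mul_addl _ _).

(* A(Gamma): the free abelian group on the canonical basis, whose element of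
   index [H] is the isomorphism class of Gamma / H. *)

Definition burnside (gT : finGroupType) := {ffun conj_class gT -> int}.
HB.instance Definition _ gT := GRing.Zmodule.on (burnside gT).

Section Burnside.
Variable gT : finGroupType.
Implicit Types (C D : conj_class gT) (X Y : gset gT).

(* [X]: the coefficient at [H] is the number of orbits isomorphic to
   Gamma / H. *)
Definition gclass X : burnside gT :=
  [ffun C => #|[set O in gorbits X |
     [exists x in O, class_of 'C[x | ract X]%G == C]]|%:Z].

Definition transitive_gset C : gset gT := coset_gset (class_rep C).

Definition burnside_one : burnside gT := gclass (point_gset gT).

(* The Z-bilinear extension of [X] [Y] = [X x Y]. *)
Definition burnside_mul (x y : burnside gT) : burnside gT :=
  \sum_C \sum_D
    gclass (prod_gset (transitive_gset C) (transitive_gset D)) *~ (x C * y D).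

Definition nfix X (H : {group gT}) : nat := #|'Fix_(ract X)(H)|.

(* The Z-linear extension of [X] |-> |X^H|; see mark_gclass. *)
Definition mark (x : burnside gT) : marks gT :=
  [ffun C => \sum_D x D * (nfix (transitive_gset D) (class_rep C))%:Z].

Definition ncont (H K : {group gT}) : nat := #|[set a | H \subset K :^ a]|.

Lemma ncontJ (H K : {group gT}) b : ncont H (K :^ b)%G = ncont H K.
Proof.
rewrite /ncont -(card_imset _ (mulgI b)); apply: eq_card => a.
rewrite [RHS]inE; apply/imsetP/idP => [[c]|Ha].
  by rewrite inE -conjsgM => Hc ->.
by exists (b^-1 * a)%g; rewrite ?inE -?conjsgM mulKVg.
Qed.

Lemma ncont_class (H K L : {group gT}) :
  class_of K = class_of L -> ncont H K = ncont H L.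
Proof.
move/eqP/class_ofP=> [a Ka]; rewrite -(ncontJ H K a).
by congr (ncont _ _); apply/val_inj.
Qed.

Lemma card_fix_orbit X (H : {group gT}) (x : X) :
  (#|'Fix_(ract X)(H) :&: orbit (ract X) [set: gT] x| * #|'C[x | ract X]|
    = ncont H 'C[x | ract X]%G)%N.
Proof.
rewrite /ncont -[RHS]sum1_card (partition_big (fun a => ract X x a)
  (fun y => y \in 'Fix_(ract X)(H) :&: orbit (ract X) [set: gT] x)); last first.
  move=> a; rewrite inE => Ha; apply/setIP; split; last exact: (@mem_orbit _ _ _ (ract X)).
  suff : H \subset 'C[ract X x a | ract X] by rewrite sub_astab1.
  by rewrite astab1_act.
rewrite -sum_nat_const; apply: eq_bigr => y /setIP[fy /orbitP[a _ xa]].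
rewrite sum1dep_card -(card_rcoset _ a); apply: eq_card => b.
rewrite mem_rcoset [RHS]inE; apply/idP/andP => [|[]].
  move/astab1P => E.
  have Eb : ract X x b = y by rewrite -xa -{2}E -actM mulgKV.
  by rewrite inE -astab1_act Eb sub_astab1 fy.
rewrite inE => _ /eqP Eb; apply/astab1P.
by rewrite actM Eb -xa actK.
Qed.

Lemma card_fix_coset (H K : {group gT}) :
  (nfix (coset_gset K) H * #|K| = ncont H K)%N.
Proof.
have Kin : (K : {set gT}) \in lcosets K [set: gT].
  by apply/lcosetsP; exists 1%g; rewrite ?inE ?lcoset1.
pose k : coset_gset K := Sub (K : {set gT}) Kin.
have stabk : 'C[k | ract (coset_gset K)] = K.
  apply/setP=> a; rewrite !inE /= sub1set inE /= -val_eqE /= -[a \in K]groupV.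
  apply/eqP/idP => [<-|Ka]; first by rewrite lcoset_refl.
  exact: lcoset_id.
have orbk : orbit (ract (coset_gset K)) [set: gT] k = setT.
  apply/setP=> A; rewrite inE; apply/orbitP.
  have /lcosetsP[b _ Ab] := valP A.
  by exists b^-1%g => //; apply/val_inj; rewrite /= invgK -Ab.
rewrite -(@ncont_class H 'C[k | ract (coset_gset K)]%G K); last first.
  by congr (class_of _); apply/val_inj.
by rewrite -card_fix_orbit orbk setIT stabk.
Qed.

Lemma nfix_orbit X (H : {group gT}) x C : class_of 'C[x | ract X]%G = C ->
  #|'Fix_(ract X)(H) :&: orbit (ract X) [set: gT] x| =
  nfix (transitive_gset C) H.
Proof.
move=> xC; have := card_fix_coset H (class_rep C).
rewrite (@ncont_class H (class_rep C) 'C[x | ract X]%G) ?class_repK //.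
rewrite -card_fix_orbit; have -> : #|class_rep C| = #|'C[x | ract X]|.
  have /eqP/class_ofP[a ->] : class_of (class_rep C) = class_of 'C[x | ract X]%G.
    by rewrite class_repK.
  by rewrite cardJg.
by move/eqP; rewrite eqn_pmul2r ?cardG_gt0 // => /eqP.
Qed.

Lemma mark_gclass X C : mark (gclass X) C = (nfix X (class_rep C))%:Z.
Proof.
rewrite ffunE /nfix; set H := class_rep C.
have P := orbit_partition (to := ract X) (G := [set: gT]) (S := setT).
have {P}P : partition (gorbits X) [set: X].
  by apply: P; apply/actsP => a _ x; rewrite !inE.
have cov : cover (gorbits X) = setT by apply: cover_partition P.
have tri : trivIset (gorbits X) by case/and3P: P.
rewrite -[in RHS]sum1_card.
under eq_bigl => x do rewrite -[_ \in _]andTb -(in_setT x) -cov.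
rewrite big_trivIset_cond //=.
pose typ (O : {set X}) := [pred C | [exists x in O, class_of 'C[x | ract X]%G == C]].
have stabE y z D : z \in orbit (ract X) [set: gT] y ->
    (class_of 'C[z | ract X]%G == D) = (class_of 'C[y | ract X]%G == D).
  case/orbitP=> a _ <-; congr (_ == _); apply/esym/eqP/class_ofP.
  by exists a; apply: (astab1_act (ract X)).
have typE y D : typ (orbit (ract X) [set: gT] y) D =
    (class_of 'C[y | ract X]%G == D).
  rewrite /typ /=; apply/exists_inP/idP => [[z zy]|yD].
    by rewrite (stabE _ _ _ zy).
  by exists y; rewrite ?orbit_refl.
rewrite (eq_bigr (fun D =>
    (\sum_(O in gorbits X | typ O D) nfix (transitive_gset D) H)%:Z)); last first.
  move=> D _; rewrite ffunE -PoszM sum_nat_const; congr (Posz (_ * _)).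
  by apply: eq_card => O; rewrite !inE.
rewrite -(big_morph Posz PoszD (erefl _)); congr Posz.
rewrite (exchange_big_dep (mem (gorbits X))) /=; last by move=> ? ? _ /andP[].
apply: eq_bigr => O OX; have /imsetP[x _ Ox] := OX.
rewrite (big_pred1 (class_of 'C[x | ract X]%G)) => [|D]; last first.
  by rewrite /= [_ \in _]OX /= -[LHS]/(typ O D) Ox typE eq_sym.
rewrite -(@nfix_orbit X H x _ erefl) -Ox -sum1_card.
by apply: eq_bigl => y; rewrite inE andbC.
Qed.

Lemma markB : {morph mark : x y / x - y}.
Proof.
move=> x y; apply/ffunP=> C; rewrite !ffunE -sumrB.
by apply: eq_bigr => D _; rewrite !ffunE mulrBl.
Qed.
HB.instance Definition _ :=
  GRing.isZmodMorphism.Build (burnside gT) (marks gT) mark markB.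

Lemma mark_inj : injective mark.
Proof.
apply: raddf_inj => x mx0; apply/ffunP => C0; rewrite ffunE; apply/eqP.
apply: contraT => xC0.
case: (arg_maxnP (fun C => #|class_rep C|) (P := fun C => x C != 0) xC0).
move=> C xC maxC; have := congr1 (fun m : marks gT => m C) mx0.
rewrite !ffunE (bigD1 C) //= big1 ?addr0 => [/eqP|D DC].
  rewrite mulf_eq0 (negbTE xC) /= eqz_nat => /eqP nf0.
  have := card_fix_coset (class_rep C) (class_rep C).
  rewrite [nfix _ _]nf0 mul0n => /esym/eqP; rewrite cards_eq0 => /eqP/setP/(_ 1%g).
  by rewrite !inE conjsg1 subxx.
have [->|xD] := eqVneq (x D) 0; first by rewrite mul0r.
suff -> : nfix (transitive_gset D) (class_rep C) = 0%N by rewrite mulr0.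
apply/eqP; rewrite -(eqn_pmul2r (cardG_gt0 (class_rep D))) mul0n.
rewrite card_fix_coset cards_eq0; apply: contraT => /set0Pn[a].
rewrite inE => CD; case/negP: DC.
rewrite -(class_repK C) -(class_repK D); apply/class_ofP.
exists a; apply/eqP; rewrite eqEcard; apply/andP; split=> //.
by rewrite cardJg; apply: maxC.
Qed.

Lemma nfix_prod X Y H : nfix (prod_gset X Y) H = (nfix X H * nfix Y H)%N.
Proof.
rewrite /nfix -cardsX; apply: eq_card => -[x y]; rewrite in_setX.
apply/afixP/andP => [h|[/afixP hx /afixP hy] a aH].
  by split; apply/afixP => a /h[].
by congr (_, _); [apply: hx | apply: hy].
Qed.

Lemma mark1 : mark burnside_one = 1.
Proof.
apply/ffunP=> C; rewrite mark_gclass ffunE /nfix (_ : #|_| = 1%N) //.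
by rewrite -card_unit -cardsT; apply: eq_card => -[]; rewrite [RHS]inE; apply/afixP.
Qed.

Lemma markM (x y : burnside gT) : mark (burnside_mul x y) = mark x * mark y.
Proof.
apply/ffunP=> C; rewrite /burnside_mul raddf_sum sum_ffunE /= !ffunE mulr_suml.
apply: eq_bigr => D _; rewrite raddf_sum sum_ffunE mulr_sumr.
apply: eq_bigr => E _; rewrite raddfMz.
have mulzE (f : marks gT) (k : int) : (f *~ k) C = k * f C.
  rewrite mulrC -mulrzz; case: k => n; rewrite /intmul ?[LHS]ffunE.
    by rewrite ffunMnE.
  by rewrite [in LHS]ffunMnE.
rewrite mulzE mark_gclass nfix_prod PoszM; exact: mulrACA.
Qed.

Fact burnside_mulA : associative burnside_mul.
Proof. by move=> x y z; apply: mark_inj; rewrite !markM mulrA. Qed.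
Fact burnside_mulC : commutative burnside_mul.
Proof. by move=> x y; apply: mark_inj; rewrite !markM mulrC. Qed.
Fact burnside_mul1 : left_id burnside_one burnside_mul.
Proof. by move=> x; apply: mark_inj; rewrite markM mark1 mul1r. Qed.
Fact burnside_mulD : left_distributive burnside_mul +%R.
Proof.
by move=> x y z; apply: mark_inj; rewrite raddfD /= !markM raddfD mulrDl.
Qed.

HB.instance Definition _ := GRing.Zmodule_isComPzRing.Build (burnside gT)
  burnside_mulA burnside_mulC burnside_mul1 burnside_mulD.

Lemma gclass_prod X Y : gclass (prod_gset X Y) = gclass X * gclass Y.
Proof.
apply: mark_inj; rewrite [RHS]markM; apply/ffunP => C.
by rewrite [RHS]ffunE !mark_gclass nfix_prod PoszM.
Qed.

End Burnside.

(* G wr Sigma_n, with [n] = {1, ..., n} replaced by 'I_n. *)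

Definition wreath (gT : finGroupType) (n : nat) : Type :=
  ({ffun 'I_n -> gT} * {perm 'I_n})%type.
HB.instance Definition _ gT n := Finite.on (wreath gT n).

Section Wreath.
Variables (gT : finGroupType) (n : nat).
Implicit Types u v w : wreath gT n.

(* perm.v composes permutations from left to right: (t * s) i = s (t i). *)
Definition wreath_mul u v : wreath gT n :=
  ([ffun i => u.1 i * v.1 ((u.2)^-1 i)], v.2 * u.2)%g.
Definition wreath_one : wreath gT n := ([ffun => 1], 1)%g.
Definition wreath_inv u : wreath gT n := ([ffun i => (u.1 (u.2 i))^-1], (u.2)^-1)%g.

Fact wreath_mulA : associative wreath_mul.
Proof.
move=> u v w; rewrite /wreath_mul /= mulgA; congr (_, _).
by apply/ffunP => i; rewrite !ffunE mulgA invMg permM.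
Qed.
Fact wreath_mul1 : left_id wreath_one wreath_mul.
Proof.
case=> g s; rewrite /wreath_mul /= mulg1; congr (_, _).
by apply/ffunP => i; rewrite !ffunE mul1g invg1 perm1.
Qed.
Fact wreath_mulV : left_inverse wreath_one wreath_inv wreath_mul.
Proof.
case=> g s; rewrite /wreath_mul /= mulgV; congr (_, _).
by apply/ffunP => i; rewrite !ffunE invgK mulVg.
Qed.
HB.instance Definition _ := Finite_isGroup.Build (wreath gT n)
  wreath_mulA wreath_mul1 wreath_mulV.

Lemma wreathM1 u v i : (u * v)%g.1 i = (u.1 i * v.1 ((u.2)^-1 i))%g.
Proof. by rewrite ffunE. Qed.
Lemma wreathM2 u v i : (u * v)%g.2 i = u.2 (v.2 i).
Proof. by rewrite permM. Qed.

Definition point_act u (i : 'I_n) : 'I_n := u.2 i.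
Fact point_act1 i : point_act 1%g i = i.
Proof. exact: perm1. Qed.
Fact point_actM u v i : point_act (u * v)%g i = point_act u (point_act v i).
Proof. exact: wreathM2. Qed.
Definition points_gset : gset (wreath gT n) := GSet point_act1 point_actM.

Section Power.
Variable X : gset gT.
Definition power_act u (x : {ffun 'I_n -> X}) : {ffun 'I_n -> X} :=
  [ffun i => gact X (u.1 i) (x ((u.2)^-1 i)%g)].
Fact power_act1 x : power_act 1%g x = x.
Proof. by apply/ffunP=> i; rewrite !ffunE gact1 invg1 perm1. Qed.
Fact power_actM u v x : power_act (u * v)%g x = power_act u (power_act v x).
Proof. by apply/ffunP=> i; rewrite !ffunE gactM invMg permM. Qed.
Definition power_gset : gset (wreath gT n) := GSet power_act1 power_actM.
End Power.

End Wreath.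

Section Transfer.
Variables (gT : finGroupType) (i j : nat).

Definition block_fun (s : {perm 'I_i}) (t : {perm 'I_j}) (k : 'I_(i + j)) :=
  unsplit (match split k with inl a => inl (s a) | inr b => inr (t b) end).
Fact block_funM s t s' t' k :
  block_fun s t (block_fun s' t' k) = block_fun (s' * s)%g (t' * t)%g k.
Proof.
by rewrite /block_fun unsplitK; case: (split k) => a; rewrite permM.
Qed.
Fact block_fun1 k : block_fun 1%g 1%g k = k.
Proof.
by rewrite /block_fun -[RHS]splitK; case: (split k) => a; rewrite perm1.
Qed.
Fact block_fun_inj s t : injective (block_fun s t).
Proof.
apply: (can_inj (g := block_fun s^-1%g t^-1%g)) => k.
by rewrite block_funM !mulgV block_fun1.
Qed.
Definition block_perm s t : {perm 'I_(i + j)} := perm (@block_fun_inj s t).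

Definition block_emb (u : wreath gT i * wreath gT j) : wreath gT (i + j) :=
  ([ffun k => match split k with inl a => u.1.1 a | inr b => u.2.1 b end],
   block_perm u.1.2 u.2.2).

Fact block_permV s t : ((block_perm s t)^-1 = block_perm s^-1 t^-1)%g.
Proof.
apply/eqP; rewrite eq_invg_mul; apply/eqP/permP => k.
by rewrite permM !permE block_funM !mulgV block_fun1.
Qed.
Fact block_embM : {in [set: wreath gT i * wreath gT j] &,
  {morph block_emb : u v / (u * v)%g}}.
Proof.
move=> [u1 u2] [v1 v2] _ _; rewrite /block_emb; congr (_, _); last first.
  by apply/permP=> k; rewrite permM !permE block_funM.
apply/ffunP => k; rewrite !ffunE /= block_permV permE /block_fun unsplitK.
by case: (split k) => a; rewrite ffunE.
Qed.
Definition block :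
    {morphism [set: wreath gT i * wreath gT j] >-> wreath gT (i + j)} :=
  Morphism block_embM.

(* The Z-bilinear extension of the transfer product of sets. *)
Definition star (x : burnside (wreath gT i)) (y : burnside (wreath gT j)) :
    burnside (wreath gT (i + j)) :=
  \sum_C \sum_D
    gclass (ind_gset block
      (extprod_gset (transitive_gset C) (transitive_gset D))) *~ (x C * y D).

End Transfer.

Definition burnside_cast (gT : finGroupType) (m n : nat) (e : m = n)
    (x : burnside (wreath gT m)) : burnside (wreath gT n) :=
  ecast k (burnside (wreath gT k)) e x.

(* The properties that characterise the total power operations. *)
Record is_total_power (gT : finGroupType)
    (P : forall n, burnside gT -> burnside (wreath gT n)) : Prop := {
  power_gclass : forall n (X : gset gT),
    P n (gclass X) = gclass (power_gset n X);
  power_zero : forall x, P 0%N x = 1;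
  power_add : forall n (x y : burnside gT),
    P n (x + y) = \sum_(i < n.+1)
      burnside_cast (subnKC (leq_ord i)) (star (P i x) (P (n - i)%N y))
}.

Section Aring.
Variables (gT : finGroupType).
Variable P : forall n, burnside gT -> burnside (wreath gT n).
Variable n : nat.

Definition basis_span (S : {set conj_class (wreath gT n)}) :
    {pred burnside (wreath gT n)} :=
  [pred a : burnside (wreath gT n) | [forall C, (a C != 0) ==> (C \in S)]].

(* The intersection of all subsets of the canonical basis whose span contains
   the image of P n; it is the least such subset, by aring_basisP. Its span
   aring P n is \mathring A(G, n). *)
Definition aring_basis : {set conj_class (wreath gT n)} :=
  \bigcap_(S : {set conj_class (wreath gT n)} |
    `[< forall x, P n x \in basis_span S >]) S.

Lemma aring_basisP x : P n x \in basis_span aring_basis.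
Proof.
apply/forallP=> C; apply/implyP=> PC; apply/bigcapP => S /asboolP/(_ x).
by move/forallP/(_ C)/implyP; apply.
Qed.

Definition aring_pred : {pred burnside (wreath gT n)} := basis_span aring_basis.

Fact aring_zmod_closed : zmod_closed aring_pred.
Proof.
split=> [|a b /forallP/= aA /forallP/= bA].
  by apply/forallP=> C; rewrite ffunE eqxx.
apply/forallP=> C; move: (aA C) (bA C); rewrite !ffunE.
case: (C \in _) => //; first by rewrite !implybT.
by rewrite !implybF !negbK => /eqP -> /eqP ->; rewrite subrr.
Qed.

Definition aring := {a | a \in aring_pred}.
HB.instance Definition _ := SubType.on aring.
HB.instance Definition _ := [Choice of aring by <:].
HB.instance Definition _ :=
  GRing.SubChoice_isSubZmodule.Build _ _ aring aring_zmod_closed.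

End Aring.
Arguments aring_pred {gT} P n.

Definition parts (gT : finGroupType) : Type :=
  multiset (conj_class gT * {m : nat | (0 < m)%N})%type.
HB.instance Definition _ gT := Choice.on (parts gT).

Section Parts.
Variable gT : finGroupType.
Implicit Types (kappa lambda mu : parts gT).

Definition parts_norm lambda : nat :=
  \sum_(k <- finsupp lambda) lambda k * val k.2.

Definition parts_fact lambda : nat :=
  \prod_(k <- finsupp lambda) (lambda k)`!.

Definition nparts (n : nat) := {lambda : parts gT | parts_norm lambda == n}.
HB.instance Definition _ n := Choice.on (nparts n).

Fact parts_norm_ge lambda k : (lambda k * val k.2 <= parts_norm lambda)%N.
Proof.
have [kl|kl] := boolP (k \in finsupp lambda).
  by rewrite /parts_norm (big_fsetD1 k) //= leq_addr.
by move: kl; rewrite mem_finsupp negbK => /eqP ->.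
Qed.

(* Parts(G, n) is finite: multiplicities and sizes are bounded by n. *)
Definition nparts_ffun n (lambda : nparts n) :
    {ffun conj_class gT * 'I_n -> 'I_n.+1} :=
  [ffun p => inord (val lambda (p.1, Sub (val p.2).+1 isT))].

Fact nparts_ffun_inj n : injective (@nparts_ffun n).
Proof.
move=> kappa lambda E; apply/val_inj/msetP => -[C [m m0]] /=.
have [mn|nm] := leqP m n; last first.
  suff z (mu : nparts n) : val mu (C, Sub m m0) = 0%N by rewrite !z.
  have := parts_norm_ge (val mu) (C, Sub m m0); rewrite (eqP (valP mu)) /=.
  case: (val mu _) => // k; rewrite mulSn => /(leq_trans (leq_addr _ _)).
  by rewrite leqNgt nm.
have bound (mu : nparts n) : (val mu (C, Sub m m0) < n.+1)%N.
  have := parts_norm_ge (val mu) (C, Sub m m0); rewrite (eqP (valP mu)) /= ltnS.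
  by apply: leq_trans; rewrite leq_pmulr.
have pm : (m.-1 < n)%N by rewrite prednK.
have := congr1 (fun f : {ffun _ -> 'I_n.+1} => val (f (C, Ordinal pm))) E.
rewrite !ffunE /= (_ : Sub m.-1.+1 isT = Sub m m0); last first.
  by apply/val_inj; rewrite /= prednK.
by rewrite !inordK; [apply | apply: bound | apply: bound].
Qed.

Definition nparts_of_ffun n (f : {ffun conj_class gT * 'I_n -> 'I_n.+1}) :
    option (nparts n) :=
  if pselect (exists mu : nparts n, nparts_ffun mu = f) is left ex
  then Some (projT1 (cid ex)) else None.
Fact nparts_ffunK n : pcancel (@nparts_ffun n) (@nparts_of_ffun n).
Proof.
move=> lambda; rewrite /nparts_of_ffun; case: pselect => [ex|[]]; last by exists lambda.
by congr Some; apply/nparts_ffun_inj; apply: (projT2 (cid ex)).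
Qed.
HB.instance Definition _ n := PCanIsCountable (@nparts_ffunK n).
HB.instance Definition _ n : isFinite (nparts n) := PCanIsFinite (@nparts_ffunK n).

Definition parks (n : nat) := {ffun nparts n -> int}.
HB.instance Definition _ n := GRing.Zmodule.on (parks n).
HB.instance Definition _ n := GRing.Zmodule_isComPzRing.Build (parks n)
  (@ffun_mulA _ _) (@ffun_mulC _ _) (@ffun_mul_1l _ _) (@ffun_mul_addl _ _).

(* The quotient of factorials is exact under the condition on the sum. *)
Definition parks_star (i j : nat) (f : parks i) (g : parks j) : parks (i + j)%N :=
  [ffun mu : nparts (i + j)%N => \sum_(kappa : nparts i) \sum_(lambda : nparts j |
       (val kappa `+` val lambda)%mset == val mu)
     (parts_fact (val mu) %/
       (parts_fact (val kappa) * parts_fact (val lambda)))%N%:R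
     * (f kappa * g lambda)].

End Parts.

(* The properties that characterise the parks homomorphism, in components:
   additivity and compatibility with the units and star products say that it is
   a homomorphism of graded rings. *)
Record is_parks_hom (gT : finGroupType)
    (P : forall n, burnside gT -> burnside (wreath gT n))
    (chi : forall n, aring P n -> parks gT n) : Prop := {
  parks_additive : forall n, zmod_morphism (chi n);
  parks_unit : forall a : aring P 0, val a = 1 -> chi 0%N a = 1;
  parks_mul : forall i j (a : aring P i) (b : aring P j) (c : aring P (i + j)%N),
    val c = star (val a) (val b) -> chi (i + j)%N c = parks_star (chi i a) (chi j b);
  parks_power : forall n (x : burnside gT) (a : aring P n) (lambda : nparts gT n),
    val a = P n x ->
    chi n a lambda =
      \prod_(k <- finsupp (val lambda)) mark x k.1 ^+ (val lambda k)
}.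

Section Beta.
Variables (gT : finGroupType) (n : nat).
Implicit Types (H : {group wreath gT n}) (i : 'I_n).

Definition isotropy H i : {set gT} :=
  [set u.1 i | u : wreath gT n in H & u.2 i == i].
Fact isotropy_group_set H i : group_set (isotropy H i).
Proof.
apply/group_setP; split.
  by apply/imsetP; exists 1%g; rewrite ?inE ?group1 /= ?perm1 ?ffunE.
move=> _ _ /imsetP[u uP ->] /imsetP[v vP ->].
move: uP vP; rewrite !inE => /andP[uH /eqP ui] /andP[vH /eqP vi].
apply/imsetP; exists (u * v)%g.
  by rewrite inE groupM //= wreathM2 vi ui.
have uVi : (u.2)^-1%g i = i by rewrite -{1}ui permK.
by rewrite wreathM1 uVi.
Qed.
Canonical isotropy_group H i := Group (isotropy_group_set H i).

Definition point_orbit H i : {set 'I_n} := orbit (ract (points_gset gT n)) H i.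

Fact point_orbit_gt0 H i : (0 < #|point_orbit H i|)%N.
Proof. by rewrite card_gt0; apply/set0Pn; exists i; apply: orbit_refl. Qed.

(* One summand ([H_ii], |Hi|) for each orbit of H on [n]. *)
Definition beta_group H : parts gT :=
  seq_mset [seq (class_of (isotropy_group H i),
                 Sub #|point_orbit H i| (point_orbit_gt0 H i))
           | i <- enum (orbit_transversal (ract (points_gset gT n)) H setT)].

Fact beta_group_norm H : parts_norm (beta_group H) == n.
Proof.
pose to := ract (points_gset gT n).
have actH : [acts H, on [set: 'I_n] | to].
  by apply/actsP => a _ i; rewrite !inE.
have /orbit_partition partP := actH.
rewrite /parts_norm -sum_mset (perm_big _ (perm_eq_seq_mset _)) big_map big_enum /=.
rewrite -[X in _ == X]card_ord -cardsT (card_partition partP).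
have trX := transversalP partP; have [_ _ uniX _] := orbit_transversalP actH.
apply/eqP; rewrite -(pblock_transversal trX) [RHS]big_imset /=; last first.
  exact: pblock_inj trX.
apply: eq_bigr => i _; congr #|pred_of_set _|.
have /and3P[_ tiP _] := partP.
by rewrite (def_pblock tiP (imset_f _ (in_setT i))) ?orbit_refl.
Qed.

(* beta_group depends only on the conjugacy class, so any representative of C
   and any choice of orbit representatives give the same value. *)
Definition beta (C : conj_class (wreath gT n)) : nparts gT n :=
  Sub (beta_group (class_rep C)) (beta_group_norm (class_rep C)).

Definition beta_star (f : parks gT n) : marks (wreath gT n) :=
  [ffun C => f (beta C)].

End Beta.

Section Subring.
Variables (R : comPzRingType) (S : {pred R}).

Definition subring_of of subring_closed S := {x | x \in S}.

Variable closedS : subring_closed S.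
Local Notation T := (subring_of closedS).
HB.instance Definition _ := SubType.on T.
HB.instance Definition _ := [Choice of T by <:].
HB.instance Definition _ := GRing.SubChoice_isSubComPzRing.Build R S T closedS.

End Subring.

Definition ring_map (R S : pzRingType) (f : R -> S) : Prop :=
  zmod_morphism f /\ monoid_morphism f.

(*    A --f--> B
      |g       |h     is a pullback square of commutative rings
      C --k--> D                                                   *)
Record is_pullback (A B C D : comPzRingType)
    (f : A -> B) (g : A -> C) (h : B -> D) (k : C -> D) : Prop := {
  pullback_top : ring_map f;
  pullback_left : ring_map g;
  pullback_right : ring_map h;
  pullback_bottom : ring_map k;
  pullback_comm : forall a, h (f a) = k (g a);
  pullback_univ : forall (T : comPzRingType) (u : T -> B) (v : T -> C),
    ring_map u -> ring_map v -> (forall t, h (u t) = k (v t)) ->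
    exists2 w : T -> A,
      [/\ ring_map w, forall t, f (w t) = u t & forall t, g (w t) = v t] &
      forall w' : T -> A, ring_map w' -> (forall t, f (w' t) = u t) ->
        (forall t, g (w' t) = v t) -> forall t, w' t = w t
}.

(* Main.v *)
Require Import Defs.
From HB Require Import structures.
From mathcomp Require Import all_boot all_order all_fingroup all_algebra.
From mathcomp Require Import finmap multiset.
From mathcomp Require Import boolp.
From mathcomp Require Import ring.

Set Implicit Arguments.
Unset Strict Implicit.
Unset Printing Implicit Defensive.

(* The library of group actions has its own gact and ract. *)
Import Defs.
Import GroupScope GRing.Theory.
Local Open Scope group_scope.
Local Open Scope ring_scope.

(** Call an element of A(G wr S_n) _from_parks_ when its mark lies in the image
    of beta_star, that is, when the number of H-fixed points depends on H only
    through beta H.  Such elements form a subring, because the marks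
    homomorphism and beta_star are ring homomorphisms.  The theorem follows from
    three facts: the ring aring P n is exactly the subring of from_parks
    elements ([aring_from_parks]), beta_star is injective ([beta_star_inj]), and
    mark a = beta_star (chi a) on aring P n ([mark_aring]).

    Marks of transfer products.  An H-fixed coset of the block subgroup is an
    H-stable set U of i points among i + j; above it, the fixed points are those
    of the groups by which H acts on U and on its complement ([mark_star]).
    Stable sets are the unions of orbits, so the beta invariants of these two
    groups split beta H into two sub-multisets, and a given splitting
    mu = kappa + lambda occurs mu! / (kappa! lambda!) times ([choices_fact]).
    Hence star on marks is parks_star on functions of beta ([parks_star_mark]).

    Powers.  A fixed point of H in X^n is determined by its values on
    representatives i of the orbits, where any fixed point of H_ii may be chosen
    ([mark_power]).  So [X^n] is from_parks, and the addition formula for the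
    total power carries this to P n x for every virtual x
    ([from_parks_total_power]).

    The basis of aring P n.  A star product of powers of orbits G/K is again a
    single orbit, and every lambda is the beta invariant of the stabiliser of
    such an orbit ([exists_monomial]); in particular beta is surjective.  As the
    mark of this orbit depends on beta only, its stabiliser contains, up to
    conjugacy, every subgroup with beta invariant lambda ([sub_monomial]).
    A maximality argument then shows that a from_parks element only involves
    star monomials ([from_parks_support]).  Conversely each of these occurs in
    some P n [X] ([monomial_in_basis]), so they are the basis of aring P n.
    Finally chi is determined on star monomials by its multiplicativity and its
    values on powers, and there it agrees with the mark. *)

(** * Marks of basis elements *)
Section Burnside.
Variable gT : finGroupType.
Implicit Types (C D : conj_class gT) (X : gset gT) (x y : burnside gT).
Implicit Types (H K L : {group gT}).

Definition basis C : burnside gT := [ffun D => (C == D)%:R].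

Lemma burnside_mulrz x (m : int) C : (x *~ m) C = x C * m.
Proof.
by rewrite -mulrzz; case: m => m; rewrite /intmul ?[LHS]ffunE ffunMnE.
Qed.

Lemma basis_expand x : x = \sum_C basis C *~ x C.
Proof.
apply/ffunP=> D; rewrite sum_ffunE (bigD1 D) //= big1 => [|C CD].
  by rewrite burnside_mulrz ffunE eqxx mul1r addr0.
by rewrite burnside_mulrz ffunE (negbTE CD) mul0r.
Qed.

Lemma mark_expand x C : mark x C = \sum_D x D * mark (basis D) C.
Proof.
rewrite {1}[x]basis_expand raddf_sum sum_ffunE; apply: eq_bigr => D _.
by rewrite raddfMz burnside_mulrz mulrC.
Qed.

Lemma class_of_conj H a : class_of (H :^ a)%G = class_of H.
Proof. by apply/esym/eqP/class_ofP; exists a. Qed.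

(** The general form of the computations of basis elements below: induced sets,
    powers of orbits and the unit are all recognised as single orbits. *)
Lemma gclass_trans X (p : X) : (forall q : X, exists a, gact X a p = q) ->
  gclass X = basis (class_of 'C[p | ract X]%G).
Proof.
move=> tr; have orbT q : orbit (ract X) [set: gT] q = setT.
  apply/setP=> r; rewrite inE; apply/orbitP.
  have [[a <-] [b <-]] := (tr q, tr r).
  by exists (a * b^-1)%g; rewrite ?inE //= /rfun -gactM invMg invgK mulgKV.
apply/ffunP=> D; rewrite !ffunE; set S := [set _ in _ | _].
have -> : S = if class_of 'C[p | ract X]%G == D then [set setT] else set0.
  apply/setP=> O; rewrite inE.
  have -> : (O \in gorbits X) = (O == setT).
    apply/imsetP/eqP => [[q _ ->]|->]; first exact: orbT.
    by exists p; rewrite ?orbT.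
  have [->|OT] := eqVneq O setT; last first.
    by case: ifP; rewrite ?inE ?(negbTE OT).
  rewrite /=; have -> : [exists q in [set: X], class_of 'C[q | ract X]%G == D] =
      (class_of 'C[p | ract X]%G == D).
    apply/exists_inP/idP => [[q _ /eqP<-]|]; last by exists p.
    have [a <-] := tr q; apply/class_ofP; exists a^-1%g; rewrite /=.
    have -> : gact X a p = ract X p a^-1%g by rewrite /= /rfun invgK.
    exact: (astab1_act (ract X)).
  by case: ifP; rewrite !inE ?eqxx.
by case: eqP; rewrite ?cards1 ?cards0.
Qed.

Lemma coset_gset_trans H : exists2 p : coset_gset H,
  'C[p | ract (coset_gset H)] = H & forall q, exists a, gact (coset_gset H) a p = q.
Proof.
have Hin : (H : {set gT}) \in lcosets H [set: gT].
  by apply/lcosetsP; exists 1%g; rewrite ?inE ?lcoset1.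
exists (Sub (H : {set gT}) Hin) => [|q].
  apply/setP=> a; rewrite !inE /= sub1set inE /= -val_eqE /= -[a \in H]groupV.
  apply/eqP/idP => [<-|Ha]; first by rewrite lcoset_refl.
  exact: lcoset_id.
by have /lcosetsP[b _ qb] := valP q; exists b; apply/val_inj.
Qed.

Lemma gclass_coset H : gclass (coset_gset H) = basis (class_of H).
Proof.
have [p pH tr] := coset_gset_trans H; rewrite (gclass_trans tr).
by congr (basis (class_of _)); apply/val_inj.
Qed.

Lemma gclass_transitive C : gclass (transitive_gset C) = basis C.
Proof. by rewrite gclass_coset class_repK. Qed.

Lemma burnside1 : 1 = basis (class_of [set: gT]%G).
Proof.
rewrite -[1]/(gclass (point_gset gT)) (@gclass_trans (point_gset gT) tt); last first.
  by case; exists 1%g.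
congr (basis (class_of _)); apply/val_inj/setP => a /=.
by rewrite !inE sub1set inE /=; apply/eqP.
Qed.

Lemma ncontJl H K b : ncont (H :^ b)%G K = ncont H K.
Proof.
rewrite /ncont -(card_imset _ (mulIg b^-1%g)); apply: eq_card => a.
rewrite [RHS]inE; apply/imsetP/idP => [[c]|Ha].
  by rewrite inE => Hc ->; rewrite conjsgM -sub_conjg.
by exists (a * b)%g; rewrite ?mulgK // inE conjsgM conjSg.
Qed.

Lemma class_rep_of H : exists a, class_rep (class_of H) = (H :^ a)%G.
Proof.
have /esym/eqP/class_ofP[a Ea] : class_of (class_rep (class_of H)) = class_of H.
  exact: class_repK.
by exists a; apply/val_inj.
Qed.

(** The factor |K| turns the number of H-fixed cosets of K into a count of group
    elements, which can be split over the cosets of a block subgroup. *)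
Lemma mark_basis H K :
  mark (basis (class_of K)) (class_of H) * #|K|%:Z = (ncont H K)%:Z.
Proof.
rewrite -gclass_transitive mark_gclass -PoszM; congr Posz.
have [a ->] := class_rep_of H; have [b Eb] := class_rep_of K.
by rewrite /transitive_gset Eb -(cardJg K b) card_fix_coset ncontJ ncontJl.
Qed.

Lemma nfixJ X H a : nfix X (H :^ a)%G = nfix X H.
Proof.
rewrite /nfix -[RHS](card_imset _ (act_inj (ract X) a)).
apply: eq_card => p; rewrite -[p](actKV (ract X) a).
rewrite [RHS](mem_imset _ _ (act_inj (ract X) a)) -!sub_astab1.
by rewrite (astab1_act (ract X)) conjSg.
Qed.

Lemma mark_gset X H : mark (gclass X) (class_of H) = (nfix X H)%:Z.
Proof. by have [a Ea] := class_rep_of H; rewrite mark_gclass Ea nfixJ. Qed.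

Lemma fixedP X H (p : X) :
  reflect (forall a, a \in H -> gact X a p = p) (p \in 'Fix_(ract X)(H)).
Proof.
apply: (iffP idP) => [/afixP fp a aH|fp]; last first.
  by apply/afixP=> a aH; apply: fp; rewrite groupV.
by have := fp a^-1%g; rewrite groupV /= /rfun invgK => /(_ aH).
Qed.

Lemma stabE X (p : X) a :
  (a \in 'C[p | ract X]) = (gact X a p == p).
Proof.
have E : ract X p a^-1%g = gact X a p by rewrite /= /rfun invgK.
by rewrite -groupV -E; apply/astab1P/eqP.
Qed.

(** Together with [mark_basis_diag] this is the triangularity of the table of
    marks with respect to subconjugacy. *)
Lemma mark_basis_neq0 C H :
  mark (basis C) (class_of H) != 0 -> exists a, H \subset class_rep C :^ a.
Proof.
move=> nz; have := mark_basis H (class_rep C); rewrite class_repK => E.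
have : (ncont H (class_rep C))%:Z != 0.
  by rewrite -E mulf_neq0 // eqz_nat -lt0n cardG_gt0.
rewrite eqz_nat -lt0n => /card_gt0P[a]; rewrite inE => Ha; by exists a.
Qed.

Lemma mark_basis_diag C : mark (basis C) C != 0.
Proof.
have := mark_basis (class_rep C) (class_rep C); rewrite class_repK => E.
have : (ncont (class_rep C) (class_rep C))%:Z != 0.
  rewrite eqz_nat -lt0n; apply/card_gt0P; exists 1%g.
  by rewrite inE conjsg1.
by rewrite -E mulf_eq0 negb_or => /andP[].
Qed.

Lemma class_rep_sub C D a :
  class_rep C \subset class_rep D :^ a -> (#|class_rep D| <= #|class_rep C|)%N -> C = D.
Proof.
move=> sub le; rewrite -(class_repK C) -(class_repK D); apply/esym/eqP/class_ofP.
by exists a; apply/eqP; rewrite eqEcard sub cardJg.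
Qed.

End Burnside.

(** * Transfer products of basis elements *)
Section Induced.
Variables (kT gT : finGroupType) (f : {morphism [set: kT] >-> gT}) (Z : gset kT).

(** Inducing Z = kT / L along f gives gT / f(L), whether or not f is injective:
    (a, z) and (1, z) are identified exactly when a = f k for some k in L. *)
Lemma gclass_ind (z : Z) : (forall y : Z, exists k, gact Z k z = y) ->
  gclass (ind_gset f Z) = basis (class_of (f @* 'C[z | ract Z])%G).
Proof.
move=> tr; pose B := balanced_gset f Z.
have inB (p : gT * Z) : orbit (ract B) [set: kT] p \in gorbits B by exact: imset_f.
pose pt p : ind_gset f Z := Sub (orbit (ract B) [set: kT] p) (inB p).
have ptE p q : (pt p == pt q) = (q \in orbit (ract B) [set: kT] p).
  by rewrite -val_eqE /= eq_sym orbit_eq_mem.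
have ptM a (p : gT * Z) : gact (ind_gset f Z) a (pt p) = pt ((a * p.1)%g, p.2).
  apply/val_inj/setP=> -[h y] /=; apply/imsetP/orbitP => [[q /orbitP[k _ <-]]|[k _ E]].
    by move=> ->; exists k; rewrite ?inE //= /rfun /balanced_act /= mulgA.
  exists (ract B p k); first by apply/orbitP; exists k.
  by rewrite -E /= /rfun /= /balanced_act /= mulgA.
rewrite (@gclass_trans _ _ (pt (1%g, z))) => [|O].
  congr (basis (class_of _)); apply/val_inj/setP => a /=.
  apply/astab1P/morphimP => [E|[k _ kC Ea]].
    have {E}/eqP: gact (ind_gset f Z) a^-1%g (pt (1%g, z)) = pt (1%g, z) by [].
    rewrite ptM /= mulg1 eq_sym ptE => /orbitP[k _ [Ea Ez]].
    exists k^-1%g; rewrite ?in_setT ?groupV //; first exact/astab1P.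
    by apply: invg_inj; rewrite -Ea mul1g.
  change (gact (ind_gset f Z) a^-1%g (pt (1%g, z)) = pt (1%g, z)).
  apply/eqP; rewrite ptM /= mulg1 eq_sym ptE; apply/orbitP; exists k^-1%g; rewrite ?inE //.
  rewrite /= /rfun /= /balanced_act /= mul1g invgK -Ea.
  have /astab1P/= E : k^-1%g \in 'C[z | ract Z] by rewrite groupV.
  by rewrite -[in RHS]E /rfun invgK.
have /imsetP[[g y] _ EO] := valP O; have [k Ek] := tr y.
exists (g * f k)%g; rewrite ptM mulg1; apply/eqP.
rewrite -val_eqE EO /= orbit_eq_mem; apply/orbitP; exists k; rewrite ?inE //.
by rewrite /= /rfun /= /balanced_act /= morphV ?inE // invgK -Ek -gactM mulVg gact1.
Qed.

End Induced.

Section StarBasis.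
Variables (gT : finGroupType) (i j : nat).
Implicit Types (C : conj_class (wreath gT i)) (D : conj_class (wreath gT j)).

Lemma star_basis_ind C D : star (basis C) (basis D) =
  gclass (ind_gset (block gT i j)
    (extprod_gset (transitive_gset C) (transitive_gset D))).
Proof.
rewrite /star (bigD1 C) //= [X in _ + X]big1 ?addr0 => [|C' CC']; last first.
  by rewrite big1 // => D' _; rewrite !ffunE eq_sym (negbTE CC') mul0r.
rewrite (bigD1 D) //= [X in _ + X]big1 ?addr0 => [|D' DD']; last first.
  by rewrite !ffunE [D == _]eq_sym (negbTE DD') mulr0.
by rewrite !ffunE !eqxx mulr1 mulr1z.
Qed.

Lemma star_bilinear (x : burnside (wreath gT i)) (y : burnside (wreath gT j)) :
  star x y = \sum_C \sum_D star (basis C) (basis D) *~ (x C * y D).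
Proof.
by apply: eq_bigr => C _; apply: eq_bigr => D _; rewrite star_basis_ind.
Qed.

Definition block_group (K : {group wreath gT i}) (L : {group wreath gT j}) :=
  (block gT i j @* setX K L)%G.

Lemma star_basis C D :
  star (basis C) (basis D) = basis (class_of (block_group (class_rep C) (class_rep D))).
Proof.
rewrite star_basis_ind.
have [p pC trp] := coset_gset_trans (class_rep C).
have [q qD trq] := coset_gset_trans (class_rep D).
rewrite (@gclass_ind _ _ _
  (extprod_gset (transitive_gset C) (transitive_gset D)) (p, q)) => [|[r s]]; last first.
  by have [[a <-] [b <-]] := (trp r, trq s); exists (a, b).
congr (basis (class_of _)); apply/val_inj => /=; congr (_ @* _).
rewrite -[in RHS]pC -[in RHS]qD; apply/setP=> -[a b].
rewrite in_setX !inE !sub1set !inE /=.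
by rewrite /rfun /= /extprod_act /= -xpair_eqE.
Qed.

End StarBasis.

(** The types agree because 0 + n reduces to n; the trivial group G wr S_0 then
    contributes nothing to the block subgroup. *)
Lemma star1x (gT : finGroupType) n (x : burnside (wreath gT n)) :
  @star gT 0 n 1 x = x :> burnside (wreath gT n).
Proof.
rewrite star_bilinear burnside1 (bigD1 (class_of [set: wreath gT 0]%G)) //=.
rewrite [X in _ + X]big1 ?addr0 => [|C CT]; last first.
  by rewrite big1 // => D _; rewrite ffunE eq_sym (negbTE CT) mul0r.
rewrite [RHS]basis_expand; apply: eq_bigr => D _.
rewrite ffunE eqxx mul1r star_basis; congr (basis _ *~ _).
rewrite -[RHS]class_repK; congr (class_of _); apply/val_inj => /=.
have blockE u : block gT 0 n u = u.2.
  case: u => u1 [g s]; congr (_, _).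
    apply/ffunP=> k; rewrite ffunE; case: splitP => [[]//|l kl] /=.
    by congr (g _); apply/val_inj.
  apply/permP=> k; rewrite permE /= /block_fun; case: splitP => [[]//|l kl] /=.
  by apply/val_inj => /=; congr (val (s _)); apply/val_inj.
have [a ->] := class_rep_of [set: wreath gT 0]%G.
apply/setP=> u; apply/morphimP/idP => [[[v w] _]|uD].
  by rewrite blockE in_setX /= => /andP[_ wD] ->.
exists (1%g, u); rewrite ?inE ?blockE //=.
by rewrite group1.
Qed.

(** * Fixed points of transfer products *)
Section BlockSubgroups.
Variables (gT : finGroupType) (i j : nat).
Local Notation W := (wreath gT (i + j)).
Local Notation blk := (block gT i j).
Implicit Types (H : {group W}) (U : {set 'I_(i + j)}) (g : W).

Lemma blockE1l (v : wreath gT i * wreath gT j) (a : 'I_i) :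
  (blk v).1 (lshift j a) = v.1.1 a.
Proof. by rewrite ffunE (unsplitK (inl a)). Qed.

Lemma blockE1r (v : wreath gT i * wreath gT j) (b : 'I_j) :
  (blk v).1 (rshift i b) = v.2.1 b.
Proof. by rewrite ffunE (unsplitK (inr b)). Qed.

Lemma blockE2l (v : wreath gT i * wreath gT j) (a : 'I_i) :
  (blk v).2 (lshift j a) = lshift j (v.1.2 a).
Proof. by rewrite permE /block_fun (unsplitK (inl a)). Qed.

Lemma blockE2r (v : wreath gT i * wreath gT j) (b : 'I_j) :
  (blk v).2 (rshift i b) = rshift i (v.2.2 b).
Proof. by rewrite permE /block_fun (unsplitK (inr b)). Qed.

Lemma lrshiftP (p : 'I_(i + j)) :
  (exists a : 'I_i, p = lshift j a) \/ (exists b : 'I_j, p = rshift i b).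
Proof.
rewrite -[p]splitK; case: (split p) => a; [left | right]; by exists a.
Qed.

Lemma block_lt (v : wreath gT i * wreath gT j) p :
  ((blk v).2 p < i)%N = (p < i)%N.
Proof.
have [[a ->]|[b ->]] := lrshiftP p; first by rewrite blockE2l /= !ltn_ord.
by rewrite blockE2r /= !ltnNge !leq_addr.
Qed.

Lemma block_inj : 'injm blk.
Proof.
apply/injmP=> -[[f1 s1] [f2 s2]] [[g1 t1] [g2 t2]] _ _ E.
congr ((_, _), (_, _)).
- by apply/ffunP=> a; have := congr1 (fun u : W => u.1 (lshift j a)) E; rewrite !blockE1l.
- by apply/permP=> a; have := congr1 (fun u : W => u.2 (lshift j a)) E;
    rewrite !blockE2l => /lshift_inj.
- by apply/ffunP=> b; have := congr1 (fun u : W => u.1 (rshift i b)) E; rewrite !blockE1r.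
- by apply/permP=> b; have := congr1 (fun u : W => u.2 (rshift i b)) E;
    rewrite !blockE2r => /rshift_inj.
Qed.

(** The block subgroup is the stabiliser of the set of the first i points, so its
    right cosets correspond to the subsets with i elements. *)
Lemma blockP (u : W) : (forall p, (u.2 p < i)%N = (p < i)%N) ->
  exists v, u = blk v.
Proof.
move=> u_lt.
have [s Es] : exists s : {perm 'I_i}, forall a, lshift j (s a) = u.2 (lshift j a).
  have fP (a : 'I_i) : (u.2 (lshift j a) < i)%N by rewrite u_lt /=.
  have f_inj : injective (fun a => Ordinal (fP a)).
    move=> a b /(congr1 val) /= E; apply: (@lshift_inj i j).
    by apply: (@perm_inj _ u.2); apply/val_inj => /=.
  by exists (perm f_inj) => a; apply/val_inj; rewrite permE.
have [t Et] : exists t : {perm 'I_j}, forall b, rshift i (t b) = u.2 (rshift i b).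
  have ge_i (b : 'I_j) : (i <= u.2 (rshift i b))%N.
    by rewrite leqNgt u_lt /= -leqNgt leq_addr.
  have fP (b : 'I_j) : (u.2 (rshift i b) - i < j)%N.
    by rewrite ltn_subLR ?ge_i.
  have f_inj : injective (fun b => Ordinal (fP b)).
    move=> a b /(congr1 val) /= E; apply: (@rshift_inj i j).
    apply: (@perm_inj _ u.2); apply/val_inj => /=.
    by rewrite -(subnKC (ge_i a)) E subnKC.
  by exists (perm f_inj) => b; apply/val_inj; rewrite permE /= subnKC.
exists (([ffun a => u.1 (lshift j a)], s), ([ffun b => u.1 (rshift i b)], t)).
rewrite [LHS]surjective_pairing [RHS]surjective_pairing; congr (_, _).
  apply/ffunP=> p; have [[a ->]|[b ->]] := lrshiftP p.
    by rewrite blockE1l ffunE.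
  by rewrite blockE1r ffunE.
apply/permP=> p; have [[a ->]|[b ->]] := lrshiftP p.
  by rewrite blockE2l /= Es.
by rewrite blockE2r /= Et.
Qed.

Lemma card_block_group (K : {group wreath gT i}) (L : {group wreath gT j}) :
  #|block_group K L| = (#|K| * #|L|)%N.
Proof. by rewrite card_injm ?subsetT ?block_inj // cardsX. Qed.

(** The invariant that separates the right cosets of the block subgroup, see
    [frontM] and [front_eq]. *)
Definition front g : {set 'I_(i + j)} := [set p | (g.2 p < i)%N].

Lemma card_front g : #|front g| = i.
Proof.
have -> : front g = g.2 @^-1: [set lshift j a | a in 'I_i].
  apply/setP=> p; rewrite !inE; apply/idP/imsetP => [lti|[a _ ->]]; last exact: (ltn_ord a).
  by exists (Ordinal lti) => //; apply/val_inj.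
by rewrite card_preimset ?card_imset ?card_ord //; [exact: lshift_inj | exact: perm_inj].
Qed.

Lemma front_surj U : #|U| = i -> exists g, front g = U.
Proof.
move=> cU; pose s := enum U ++ enum (~: U).
have mem_s p : p \in s by rewrite mem_cat !mem_enum inE orbN.
have size_s : size s = (i + j)%N.
  by rewrite size_cat -!cardE cardsC card_ord.
have fP p : (index p s < i + j)%N by apply: leq_trans (eq_leq size_s); rewrite index_mem.
have f_inj : injective (fun p => Ordinal (fP p)).
  move=> p q /(congr1 val) /= E.
  by rewrite -(nth_index p (mem_s p)) E nth_index.
exists ([ffun => 1%g], perm f_inj); apply/setP=> p.
rewrite inE permE /= index_cat mem_enum; case: ifP => pU.
  by rewrite -[X in (_ < X)%N]cU cardE index_mem mem_enum.
by rewrite -cardE cU ltnNge leq_addr.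
Qed.

Lemma frontM (v : wreath gT i * wreath gT j) g : front (blk v * g)%g = front g.
Proof. by apply/setP=> p; rewrite !inE wreathM2 block_lt. Qed.

Lemma front_eq g h : front g = front h -> exists v, h = (blk v * g)%g.
Proof.
move=> E; have [|v Ev] := @blockP (h * g^-1)%g; last first.
  by exists v; rewrite -Ev mulgKV.
move=> p; have := congr1 (fun U => (g^-1)%g.2 p \in U) E.
by rewrite !inE wreathM2 -(wreathM2 g) mulgV perm1 => ->.
Qed.

Definition stable n (H : {group wreath gT n}) (U : {set 'I_n}) :=
  [forall h in H, forall p, ((h : wreath gT n).2 p \in U) == (p \in U)].

Lemma stableP n (H : {group wreath gT n}) (U : {set 'I_n}) :
  reflect (forall h p, h \in H -> (h.2 p \in U) = (p \in U)) (stable H U).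
Proof.
apply: (iffP 'forall_in_forallP) => [S h p /S/(_ p)/eqP|S h hH p] //.
by rewrite S.
Qed.

(** When front g is H-stable, the conjugate of H by the inverse of g lies in the
    block subgroup; its two projections are the actions of H on front g and on
    the complement, transported to 'I_i and 'I_j by g. *)
Definition preblock H g := (blk @*^-1 (H :^ g^-1))%G.
Definition left_part H g := [group of (@fst _ _ @* preblock H g)].
Definition right_part H g := [group of (@snd _ _ @* preblock H g)].

Lemma block_preblock H g : stable H (front g) ->
  blk @* preblock H g = H :^ g^-1.
Proof.
move/stableP=> S; apply: morphpreK; apply/subsetP=> u.
rewrite mem_conjgV => uH; have [p|v ->] := @blockP u; last by rewrite mem_morphim ?inE.
have := S _ (g^-1%g.2 p) uH.
rewrite !inE conjgE !wreathM2 -!(wreathM2 g g^-1%g) mulgV.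
by rewrite !perm1.
Qed.

(** For fixed front g, containment in a conjugate of a block subgroup decouples
    into one condition on each block. *)
Lemma sub_block_conj H g K L v : stable H (front g) ->
  (H \subset block_group K L :^ (blk v * g)) =
  (left_part H g \subset K :^ v.1) && (right_part H g \subset L :^ v.2).
Proof.
move=> S; rewrite conjsgM -sub_conjgV -block_preblock // -morphimJ ?inE //.
rewrite injmSK ?block_inj ?subsetT //.
apply/subsetP/andP => [sub | [/subsetP subl /subsetP subr] [a b] ab].
  split; apply/subsetP=> _ /morphimP[[a b] _ ab ->];
    by have := sub _ ab; rewrite !mem_conjg in_setX => /andP[].
have := subl a; rewrite mem_conjg => Ka; have := subr b; rewrite mem_conjg => Lb.
rewrite mem_conjg in_setX; apply/andP; split; [apply: Ka | apply: Lb].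
  by apply: (mem_morphim (fst_morphism _ _) (in_setT _) ab).
by apply: (mem_morphim (snd_morphism _ _) (in_setT _) ab).
Qed.

(** The elements counted on the left are sorted by their front, which is then
    H-stable; those with front U form the coset of g_ U, and [sub_block_conj]
    turns the count over this coset into a product. *)
Lemma ncont_block H (K : {group wreath gT i}) (L : {group wreath gT j})
    (g_ : {set 'I_(i + j)} -> W) :
    (forall U, #|U| = i -> front (g_ U) = U) ->
  ncont H (block_group K L) = (\sum_(U | stable H U && (#|U| == i))
     ncont (left_part H (g_ U)) K * ncont (right_part H (g_ U)) L)%N.
Proof.
move=> g_K; rewrite /ncont -sum1_card.
rewrite (partition_big front (fun U => stable H U && (#|U| == i))) /=; last first.
  move=> g; rewrite inE card_front eqxx andbT => HB.
  apply/stableP=> h p hH; have := subsetP HB h hH.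
  rewrite mem_conjg => /morphimP[v _ _ Ev].
  have := block_lt v (g.2 p); rewrite -Ev conjgE invgK !wreathM2.
  by rewrite -(wreathM2 g^-1%g g) mulVg perm1 !inE.
apply: eq_bigr => U /andP[stU /eqP cU]; set g := g_ U.
have gU : front g = U by exact: g_K.
rewrite sum1dep_card -cardsX.
have f_inj : injective (fun v => blk v * g)%g.
  by move=> v w /mulIg; apply: (injmP block_inj); rewrite inE.
rewrite -(card_imset _ f_inj); apply: eq_card => h.
apply/idP/imsetP.
  rewrite [h \in _]inE => /andP[Hh /eqP hU]; have [v Ev] : exists v, h = (blk v * g)%g.
    by apply: front_eq; rewrite gU.
  case: v Ev => a b Ev; exists (a, b) => //; move: Hh; rewrite inE Ev sub_block_conj ?gU //.
  by rewrite in_setX !inE.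
case=> -[a b]; rewrite in_setX !inE => Hv ->.
by rewrite sub_block_conj ?gU // Hv frontM gU eqxx.
Qed.

Lemma mark_star (x : burnside (wreath gT i)) (y : burnside (wreath gT j)) H
    (g_ : {set 'I_(i + j)} -> W) :
    (forall U, #|U| = i -> front (g_ U) = U) ->
  mark (star x y) (class_of H) = \sum_(U | stable H U && (#|U| == i))
     mark x (class_of (left_part H (g_ U))) * mark y (class_of (right_part H (g_ U))).
Proof.
move=> g_K; pose S U := stable H U && (#|U| == i).
have basis_case C D : mark (star (basis C) (basis D)) (class_of H) =
    \sum_(U | S U) mark (basis C) (class_of (left_part H (g_ U))) *
                   mark (basis D) (class_of (right_part H (g_ U))).
  have nzK (g1 : finGroupType) (K : {group g1}) : #|K|%:Z != 0.
    by rewrite eqz_nat -lt0n cardG_gt0.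
  rewrite star_basis; apply: (mulIf (nzK _ (block_group (class_rep C) (class_rep D)))).
  rewrite mark_basis (ncont_block _ _ _ g_K) card_block_group mulr_suml.
  rewrite (big_morph Posz PoszD (erefl _)); apply: eq_bigr => U _.
  rewrite !PoszM -!mark_basis !class_repK; ring.
rewrite star_bilinear raddf_sum sum_ffunE.
under [RHS]eq_bigr => U _ do rewrite (mark_expand x) (mark_expand y) mulr_suml.
rewrite exchange_big; apply: eq_bigr => C _.
under [RHS]eq_bigr => U _ do rewrite mulr_sumr.
rewrite raddf_sum sum_ffunE exchange_big; apply: eq_bigr => D _.
rewrite raddfMz burnside_mulrz basis_case mulr_suml.
by apply: eq_bigr => U _; ring.
Qed.

End BlockSubgroups.

(** * Counting sub-multisets *)
Section SubMultisets.
Variable gT : finGroupType.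
Local Notation plab := (conj_class gT * {m : nat | (0 < m)%N})%type.
Implicit Types kappa lambda mu : parts gT.

Lemma parts_fact_mset0 : parts_fact (mset0 : parts gT) = 1%N.
Proof. by rewrite /parts_fact finsupp0 big_seq_fset0. Qed.

Lemma parts_factE mu (S : {fset plab}) : (finsupp mu `<=` S)%fset ->
  parts_fact mu = (\prod_(k <- S) (mu k)`!)%N.
Proof.
move=> sub; rewrite /parts_fact; apply: big_fset_incl => // k _.
by rewrite memNfinsupp => /eqP ->.
Qed.

Lemma parts_fact_mset1D k mu :
  parts_fact (k +` mu)%mset = ((mu k).+1 * parts_fact mu)%N.
Proof.
pose S := (k |` finsupp mu)%fset.
rewrite (@parts_factE (k +` mu)%mset S); last first.
  apply/fsubsetP=> l; rewrite mem_finsupp mset1DE !inE mem_finsupp.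
  by case: (l == k).
rewrite (@parts_factE mu S); last by apply/fsubsetP=> l; rewrite !inE => ->; rewrite orbT.
have kS : k \in S by rewrite !inE eqxx.
have ES : (\prod_(l <- (S `\ k)%fset) ((k +` mu)%mset l)`! =
           \prod_(l <- (S `\ k)%fset) (mu l)`!)%N.
  apply: eq_big_seq => l; rewrite in_fsetD1 => /andP[lk _].
  by rewrite mset1DE (negbTE lk).
by rewrite !(big_fsetD1 k kS) /= ES mset1DE eqxx add1n factS mulnA.
Qed.

Lemma parts_fact_gt0 mu : (0 < parts_fact mu)%N.
Proof. by rewrite prodn_gt0 // => k; apply: fact_gt0. Qed.

Section Choose.
Variables (I : finType) (lab : I -> plab).
Implicit Types (R T : {set I}) (r : I).

Definition lab_mset (T : {set I}) : parts gT := seq_mset [seq lab r | r <- enum T].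

Lemma lab_mset0 : lab_mset set0 = mset0.
Proof. by apply/msetP=> k; rewrite mset_seqE enum_set0 mset0E. Qed.

Lemma lab_msetE T k : lab_mset T k = #|[set r in T | lab r == k]|.
Proof.
rewrite mset_seqE count_map cardE -size_filter; apply: perm_size.
apply: uniq_perm; rewrite ?enum_uniq ?(filter_uniq _ (enum_uniq _)) // => r.
by rewrite mem_filter !mem_enum [RHS]inE andbC.
Qed.

Lemma lab_mset1U r T :
  r \notin T -> lab_mset (r |: T) = (lab r +` lab_mset T)%mset.
Proof.
move=> rT; apply/msetP=> k; rewrite mset1DE !lab_msetE.
rewrite (cardsD1 r) !inE eqxx /= [k == _]eq_sym; congr (_ + _)%N.
apply: eq_card => s; rewrite !inE.
by have [->|] := eqVneq s r; rewrite //= (negbTE rT).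
Qed.

Lemma lab_msetID R T :
  (lab_mset (R :&: T) `+` lab_mset (R :&: ~: T))%mset = lab_mset R.
Proof.
apply/msetP=> k; rewrite msetE2 !lab_msetE -(cardsID T [set r in R | lab r == k]).
by congr (_ + _)%N; apply: eq_card => r; rewrite !inE; case: (r \in T); rewrite ?andbF ?andbT.
Qed.

Definition choices (R : {set I}) kappa :=
  #|[set T : {set I} | (T \subset R) && (lab_mset T == kappa)]|.

(** This is the product over the labels k of the binomial coefficients of
    mu k over kappa k, proved by removing an element r of R with label k.  Write
    mu = k + mu'.  After multiplication by kappa! lambda!, the selections
    avoiding r contribute lambda k * mu'!, those containing r contribute
    kappa k * mu'!, and (lambda k + kappa k) * mu'! = mu!. *)
Lemma choices_fact (R : {set I}) kappa lambda :
  (kappa `+` lambda)%mset = lab_mset R ->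
  (choices R kappa * (parts_fact kappa * parts_fact lambda) = parts_fact (lab_mset R))%N.
Proof.
have [m] := ubnP #|R|; elim: m => // m IH in R kappa lambda *.
rewrite ltnS => Rm; have [->|[r rR]] := set_0Vmem R.
  rewrite lab_mset0 => E; have kl k : kappa k = 0%N /\ lambda k = 0%N.
    have := congr1 (fun mu : parts gT => mu k) E; rewrite msetE2 mset0E.
    by move/eqP; rewrite addn_eq0 => /andP[/eqP-> /eqP->].
  have -> : kappa = mset0 by apply/msetP=> k; rewrite mset0E (kl k).1.
  have -> : lambda = mset0 by apply/msetP=> k; rewrite mset0E (kl k).2.
  rewrite parts_fact_mset0 !muln1 /choices.
  rewrite (_ : [set _ | _] = [set set0]) ?cards1 //.
  apply/setP=> T; rewrite !inE subset0; case: eqP => // ->.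
  by rewrite lab_mset0 eqxx.
set R' := R :\ r; have rR' : r \notin R' by rewrite !inE eqxx.
have RE : R = r |: R' by rewrite setD1K.
have R'm : (#|R'| < m)%N by move: Rm; rewrite (cardsD1 r R) rR.
rewrite {1}RE lab_mset1U // => E.
set k := lab r in E; set mu := lab_mset R' in E *.
have Ek l : (kappa l + lambda l = (l == k) + mu l)%N.
  by rewrite -mset1DE -E msetE2.
(* B counts the selections that contain r, through their remaining elements. *)
pose A := [set T : {set I} | (T \subset R') && (lab_mset T == kappa)].
pose B := [set T : {set I} | (T \subset R') && ((k +` lab_mset T)%mset == kappa)].
have -> : choices R kappa = (#|A| + #|B|)%N.
  rewrite /choices; set C := [set _ | _].
  rewrite -(cardsID [set T : {set I} | r \notin T] C); congr (_ + _)%N.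
    apply: eq_card => T; rewrite !inE RE andbAC; congr (_ && _).
    apply/andP/idP => [[TR rT]|TR'].
      by apply/subsetP=> s sT; move/subsetP: TR => /(_ s sT); rewrite !inE;
        case: eqP => // sr; rewrite -sr sT in rT.
    split; first exact: subset_trans TR' (subsetUr _ _).
    by apply: contra rR' => /(subsetP TR').
  have f_inj : {in B &, injective (fun T : {set I} => r |: T)}.
    move=> T1 T2; rewrite !inE => /andP[s1 _] /andP[s2 _] E12.
    have n1 : r \notin T1 by apply: contra rR' => /(subsetP s1).
    have n2 : r \notin T2 by apply: contra rR' => /(subsetP s2).
    by rewrite -(setU1K n1) E12 setU1K.
  rewrite -(card_in_imset f_inj); apply: eq_card => T.
  rewrite !inE negbK; apply/andP/imsetP => [[rT /andP[TR TK]]|[T' T'B ->]].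
    exists (T :\ r); last by rewrite setD1K.
    have nT : r \notin T :\ r by rewrite !inE eqxx.
    by rewrite inE -(lab_mset1U nT) setD1K // TK andbT setSD.
  move: T'B; rewrite inE => /andP[s1 /eqP Ek'].
  have n1 : r \notin T' by apply: contra rR' => /(subsetP s1).
  rewrite !inE eqxx lab_mset1U // Ek' eqxx andbT; split=> //.
  by rewrite RE; apply: setUS.
have partA : (#|A| * (parts_fact kappa * parts_fact lambda) = lambda k * parts_fact mu)%N.
  have [l0|l0] := posnP (lambda k).
    rewrite l0 mul0n; apply/eqP; rewrite muln_eq0 cards_eq0; apply/orP; left.
    apply/eqP/setP=> T; rewrite !inE; apply/negP => /andP[TR /eqP TK].
    have := Ek k; rewrite l0 eqxx addn0 -TK => E'.
    have : (lab_mset T k <= mu k)%N.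
      rewrite !lab_msetE subset_leq_card //; apply/subsetP=> s.
      by rewrite !inE => /andP[/(subsetP TR) + ->]; rewrite !inE => ->.
    by rewrite E' ltnn.
  pose lambda' : parts gT := (lambda `\ k)%mset.
  have El : lambda = (k +` lambda')%mset.
    apply/msetP=> l; rewrite mset1DE msetB1E.
    by case: eqP => [->|_]; rewrite ?add1n ?subn1 ?prednK ?subn0.
  rewrite {1}El parts_fact_mset1D -[in RHS](IH R' kappa lambda') //; last first.
    apply/msetP=> l; have := Ek l; by rewrite {1}El !(mset1DE, msetE2) addnCA => /addnI.
  by rewrite msetB1E eqxx subn1 prednK // -/(choices R' kappa); ring.
have partB : (#|B| * (parts_fact kappa * parts_fact lambda) = kappa k * parts_fact mu)%N.
  have [l0|l0] := posnP (kappa k).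
    rewrite l0 mul0n; apply/eqP; rewrite muln_eq0 cards_eq0; apply/orP; left.
    apply/eqP/setP=> T; rewrite !inE; apply/negP => /andP[TR /eqP TK].
    by move: l0; rewrite -TK mset1DE eqxx.
  pose kappa' : parts gT := (kappa `\ k)%mset.
  have El : kappa = (k +` kappa')%mset.
    apply/msetP=> l; rewrite mset1DE msetB1E.
    by case: eqP => [->|_]; rewrite ?add1n ?subn1 ?prednK ?subn0.
  rewrite {1}El parts_fact_mset1D -[in RHS](IH R' kappa' lambda) //; last first.
    apply/msetP=> l; have := Ek l; by rewrite {1}El !(mset1DE, msetE2) -addnA => /addnI.
  have -> : #|B| = choices R' kappa'.
    apply: eq_card => T; rewrite !inE; congr (_ && _); apply/eqP/eqP => E1; last by rewrite E1 -El.
    by apply/msetP=> l; rewrite msetB1E -E1 mset1DE addKn.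
  by rewrite msetB1E eqxx subn1 prednK //; ring.
rewrite mulnDl partA partB RE lab_mset1U // parts_fact_mset1D -/mu -mulnDl.
by rewrite addnC Ek eqxx.
Qed.

End Choose.
End SubMultisets.

(** * Orbit labels and beta *)
Section Labels.
Variables (gT : finGroupType) (n : nat).
Local Notation W := (wreath gT n).
Local Notation plab := (conj_class gT * {m : nat | (0 < m)%N})%type.
Implicit Types (H : {group W}) (U T : {set 'I_n}) (g : W) (p q r : 'I_n).

(** The summand that the orbit of p contributes to beta H; here it is attached to
    every point, since labels of points are easier to transport than
    representatives of orbits. *)
Definition label H p : plab :=
  (class_of (isotropy_group H p), Sub #|point_orbit H p| (point_orbit_gt0 H p)).

Lemma wreathKV g p : g.2 (g^-1%g.2 p) = p.
Proof. by rewrite -wreathM2 mulgV perm1. Qed.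

Lemma wreathK g p : g^-1%g.2 (g.2 p) = p.
Proof. by rewrite -wreathM2 mulVg perm1. Qed.

Lemma point_orbitP H p q :
  reflect (exists2 h, h \in H & h.2 p = q) (q \in point_orbit H p).
Proof.
apply: (iffP orbitP) => [[h hH <-]|[h hH <-]]; exists h^-1%g; rewrite ?groupV //.
by rewrite /= /rfun invgK.
Qed.

Lemma isotropyP H p c :
  reflect (exists2 h, h \in H & h.2 p = p /\ h.1 p = c) (c \in isotropy H p).
Proof.
apply: (iffP imsetP) => [[h]|[h hH [hp <-]]].
  by rewrite inE => /andP[hH /eqP hp] ->; exists h.
by exists h => //; rewrite inE hH hp eqxx.
Qed.

(** The isotropy group at g p of the conjugate of H is the isotropy group of H at
    p, conjugated by the G-component of g at g p. *)
Lemma label_conj H g p : label (H :^ g^-1)%G (g.2 p) = label H p.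
Proof.
congr (_, _); last first.
  apply/val_inj => /=; rewrite -[RHS](card_imset _ (@perm_inj _ g.2)).
  apply: eq_card => q.
 apply/point_orbitP/imsetP => [[h]|[r /point_orbitP[h hH <-] ->]].
    rewrite mem_conjgV => hH <-; exists ((h ^ g)%g.2 p).
      by apply/point_orbitP; exists (h ^ g)%g.
    by rewrite conjgE !wreathM2 wreathKV.
  exists (h ^ g^-1)%g; first by rewrite mem_conjgV conjgKV.
  by rewrite conjgE !wreathM2 invgK wreathK.
rewrite -[RHS](class_of_conj _ (g.1 (g.2 p))^-1%g); congr (class_of _).
have E (h : W) : h.2 p = p ->
    (h ^ g^-1)%g.1 (g.2 p) = (h.1 p ^ (g.1 (g.2 p))^-1)%g.
  move=> hp; rewrite !conjgE !invgK wreathM1 wreathM1.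
  have -> : (g.2^-1)%g (g.2 p) = p by rewrite permK.
  have -> : (h.2^-1)%g p = p by rewrite -{1}hp permK.
  by rewrite ffunE.
apply/val_inj/setP => c /=; apply/isotropyP/idP => [[h]|].
  rewrite mem_conjgV => hH [hp <-].
  have hgp : (h ^ g)%g.2 p = p by rewrite conjgE !wreathM2 hp wreathK.
  rewrite -[h](conjgK g) E // memJ_conjg.
  by apply/isotropyP; exists (h ^ g)%g.
rewrite mem_conjgV => /isotropyP[h hH [hp hc]].
exists (h ^ g^-1)%g; first by rewrite mem_conjgV conjgKV.
by split; [rewrite conjgE invgK !wreathM2 wreathK hp | rewrite E // hc conjgK].
Qed.

Lemma label_orbit H p q : q \in point_orbit H p -> label H q = label H p.
Proof.
case/point_orbitP=> h hH <-; rewrite -[RHS](label_conj H h).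
by congr (label _ _); apply/val_inj; rewrite /= conjGid ?groupV.
Qed.

Definition orbit_reps H : {set 'I_n} :=
  orbit_transversal (ract (points_gset gT n)) H setT.

Definition orbit_rep H p : 'I_n :=
  odflt p [pick r in orbit_reps H | p \in point_orbit H r].

Lemma point_orbit_sym H p q : (q \in point_orbit H p) = (p \in point_orbit H q).
Proof. exact: orbit_sym. Qed.

Lemma point_orbit_trans H p q r :
  q \in point_orbit H p -> r \in point_orbit H q -> r \in point_orbit H p.
Proof. by move=> pq qr; apply: orbit_trans qr pq. Qed.

Lemma orbit_repsP H :
  {in orbit_reps H &, forall r s, s \in point_orbit H r -> r = s} /\
  forall p, exists2 r, r \in orbit_reps H & p \in point_orbit H r.
Proof.
have actH : [acts H, on [set: 'I_n] | ract (points_gset gT n)].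
  by apply/actsP => a _ p; rewrite !inE.
have [_ _ inj ex] := orbit_transversalP actH.
split=> [r s rR sR|p]; first by rewrite inj // => /eqP.
have [a aH apR] := ex p (in_setT p); eexists; first exact: apR.
by rewrite point_orbit_sym; apply: mem_orbit.
Qed.

Lemma orbit_repP H p :
  orbit_rep H p \in orbit_reps H /\ p \in point_orbit H (orbit_rep H p).
Proof.
rewrite /orbit_rep; case: pickP => [r /andP[] //|none].
have [r rR pr] := (orbit_repsP H).2 p.
by have := none r; rewrite /= rR pr.
Qed.

Lemma orbit_rep_eq H p r : r \in orbit_reps H ->
  (orbit_rep H p == r) = (p \in point_orbit H r).
Proof.
have [sR ps] := orbit_repP H p => rR; apply/eqP/idP => [<- //|pr].
apply: (orbit_repsP H).1 => //; apply: point_orbit_trans ps _.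
by rewrite point_orbit_sym.
Qed.

Lemma stable_orbit H U p q :
  stable H U -> q \in point_orbit H p -> (q \in U) = (p \in U).
Proof. by move/stableP=> S /point_orbitP[h hH <-]; apply: S. Qed.

Lemma card_stable H U : stable H U ->
  #|U| = (\sum_(r in orbit_reps H :&: U) #|point_orbit H r|)%N.
Proof.
move=> S; rewrite -[LHS]sum1_card.
rewrite (partition_big (orbit_rep H) (fun r => r \in orbit_reps H :&: U)) /=.
  apply: eq_bigr => r; rewrite inE => /andP[rR rU]; rewrite -sum1_card.
  apply: eq_bigl => p; rewrite orbit_rep_eq //.
  by case pr: (p \in point_orbit H r); rewrite ?andbF // (stable_orbit S pr) rU.
move=> p pU; have [rR pr] := orbit_repP H p.
by rewrite inE rR -(stable_orbit S pr).
Qed.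

Local Notation label_mset H T := (lab_mset (label H) T).

(** An orbit with label (C, m) has m points, all with this label. *)
Lemma stable_labels H U k : stable H U ->
  (label_mset H (orbit_reps H :&: U) k * val k.2
     = #|[set p in U | label H p == k]|)%N.
Proof.
move=> S; rewrite (@card_stable H); last first.
  apply/stableP=> h p hH; have ph : h.2 p \in point_orbit H p.
    by apply/point_orbitP; exists h.
  by rewrite !inE (label_orbit ph) (stable_orbit S ph).
rewrite lab_msetE -sum_nat_const; apply: eq_big => [r|r].
  by rewrite !inE andbA.
by rewrite inE => /andP[_ /eqP<-].
Qed.

Lemma label_mset_norm H U : stable H U ->
  parts_norm (label_mset H (orbit_reps H :&: U)) = #|U|.
Proof.
move/card_stable->; rewrite /parts_norm -sum_mset.
by rewrite (perm_big _ (perm_eq_seq_mset _)) big_map big_enum.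
Qed.

Lemma beta_groupE H : beta_group H = label_mset H (orbit_reps H).
Proof. by []. Qed.

(** As the sizes val k.2 are positive, this determines beta H from the labels of
    the points alone, with no choice of representatives. *)
Lemma beta_labels H k :
  (beta_group H k * val k.2 = #|[set p | label H p == k]|)%N.
Proof.
rewrite beta_groupE -[orbit_reps H]setIT stable_labels.
  by apply: eq_card => p; rewrite !inE.
by apply/stableP=> h p _; rewrite !inE.
Qed.

Lemma parts_eq (kappa lambda : parts gT) :
  (forall k, kappa k * val k.2 = lambda k * val k.2)%N -> kappa = lambda.
Proof.
move=> E; apply/msetP=> k; apply/eqP.
by rewrite -(eqn_pmul2r (valP k.2)); apply/eqP; apply: E.
Qed.

Lemma beta_group_label H K : label H =1 label K -> beta_group H = beta_group K.
Proof.
move=> E; apply: parts_eq => k; rewrite !beta_labels.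
by rewrite (funext E).
Qed.

Lemma val_beta H : val (beta (class_of H)) = beta_group H.
Proof.
rewrite /=; have [a ->] := class_rep_of H; apply: parts_eq => k.
rewrite !beta_labels -[LHS](card_imset _ (@perm_inj _ a.2)).
apply: eq_card => p; rewrite -[p](wreathKV a) (mem_imset _ _ (@perm_inj _ a.2)) !inE.
by rewrite -[label _ _](label_conj _ a) (_ : (_ :^ _)%G = H) //; apply/val_inj/conjsgK.
Qed.

End Labels.

(** * Beta on blocks *)
Section BlockLabels.
Variables (gT : finGroupType) (i j : nat).
Local Notation W := (wreath gT (i + j)).
Local Notation blk := (block gT i j).
Implicit Types (H : {group W}) (M : {group wreath gT i * wreath gT j}).

Lemma label_block_left M a :
  label (blk @* M)%G (lshift j a) = label (@fst _ _ @* M)%G a.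
Proof.
congr (_, _); last first.
  apply/val_inj => /=; rewrite -[RHS](card_imset _ (@lshift_inj i j)).
  apply: eq_card => q; apply/point_orbitP/imsetP.
    case=> _ /morphimP[v _ vM ->] <-; exists (v.1.2 a); last by rewrite blockE2l.
    by apply/point_orbitP; exists v.1 => //; apply: mem_morphim; rewrite ?inE.
  case=> b /point_orbitP[_ /morphimP[v _ vM ->] <-] ->.
  by exists (blk v); rewrite ?blockE2l // mem_morphim ?inE.
congr (class_of _); apply/val_inj/setP=> c /=; apply/isotropyP/isotropyP.
  case=> _ /morphimP[v _ vM ->]; rewrite blockE2l blockE1l => -[/lshift_inj va vc].
  by exists v.1 => //; apply: mem_morphim; rewrite ?inE.
case=> _ /morphimP[v _ vM ->] [va vc].
by exists (blk v); rewrite ?blockE2l ?blockE1l ?va // mem_morphim ?inE.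
Qed.

Lemma label_block_right M b :
  label (blk @* M)%G (rshift i b) = label (@snd _ _ @* M)%G b.
Proof.
congr (_, _); last first.
  apply/val_inj => /=; rewrite -[RHS](card_imset _ (@rshift_inj i j)).
  apply: eq_card => q; apply/point_orbitP/imsetP.
    case=> _ /morphimP[v _ vM ->] <-; exists (v.2.2 b); last by rewrite blockE2r.
    by apply/point_orbitP; exists v.2 => //; apply: mem_morphim; rewrite ?inE.
  case=> a /point_orbitP[_ /morphimP[v _ vM ->] <-] ->.
  by exists (blk v); rewrite ?blockE2r // mem_morphim ?inE.
congr (class_of _); apply/val_inj/setP=> c /=; apply/isotropyP/isotropyP.
  case=> _ /morphimP[v _ vM ->]; rewrite blockE2r blockE1r => -[/rshift_inj va vc].
  by exists v.2 => //; apply: mem_morphim; rewrite ?inE.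
case=> _ /morphimP[v _ vM ->] [va vc].
by exists (blk v); rewrite ?blockE2r ?blockE1r ?va // mem_morphim ?inE.
Qed.

Lemma beta_block_group (K : {group wreath gT i}) (L : {group wreath gT j}) :
  beta_group (block_group K L) = (beta_group K `+` beta_group L)%mset.
Proof.
have El a : label (block_group K L) (lshift j a) = label K a.
  rewrite label_block_left; congr (label _ _); apply/val_inj.
  by rewrite /= morphim_fstX.
have Er b : label (block_group K L) (rshift i b) = label L b.
  rewrite label_block_right; congr (label _ _); apply/val_inj.
  by rewrite /= morphim_sndX.
apply: parts_eq => k; rewrite msetE2 mulnDl !beta_labels -!sum1dep_card.
have Sl : (\sum_(a | label K a == k) 1 =
    \sum_(a | label (block_group K L) (lshift j a) == k) 1)%N.
  by apply: eq_bigl => a; rewrite El.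
have Sr : (\sum_(b | label L b == k) 1 =
    \sum_(b | label (block_group K L) (rshift i b) == k) 1)%N.
  by apply: eq_bigl => b; rewrite Er.
rewrite {}Sl {}Sr; move: (label _) => lab; exact: big_split_ord.
Qed.

Section Parts.
Variables (H : {group W}) (g : W).
Hypothesis Hg : stable H (front g).

Lemma label_preblock q : label H (g^-1%g.2 q) = label (blk @* preblock H g)%G q.
Proof.
rewrite -(label_conj H g) wreathKV.
suff -> : (blk @* preblock H g)%G = (H :^ g^-1)%G by [].
by apply/val_inj; rewrite -[RHS](block_preblock Hg).
Qed.

Lemma beta_left_part :
  beta_group (left_part H g) = lab_mset (label H) (orbit_reps H :&: front g).
Proof.
apply: parts_eq => k; rewrite beta_labels stable_labels //.
rewrite -[RHS](card_imset _ (@perm_inj _ g.2)) -[LHS](card_imset _ (@lshift_inj i j)).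
apply: eq_card => p; rewrite -[p in RHS](wreathKV g) (mem_imset _ _ (@perm_inj _ g.2)).
rewrite !inE wreathKV label_preblock; have [[a ->]|[b ->]] := lrshiftP p.
  by rewrite mem_imset ?inE ?label_block_left /= ?ltn_ord //; exact: lshift_inj.
rewrite ltnNge leq_addr; apply/imsetP=> -[a _ /eqP].
by rewrite eq_rlshift.
Qed.

Lemma beta_right_part :
  beta_group (right_part H g) = lab_mset (label H) (orbit_reps H :&: ~: front g).
Proof.
have SC : stable H (~: front g).
  by apply/stableP=> h p hH; rewrite !in_setC (stableP _ _ Hg).
apply: parts_eq => k; rewrite beta_labels stable_labels //.
rewrite -[RHS](card_imset _ (@perm_inj _ g.2)) -[LHS](card_imset _ (@rshift_inj i j)).
apply: eq_card => p; rewrite -[p in RHS](wreathKV g) (mem_imset _ _ (@perm_inj _ g.2)).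
rewrite !inE wreathKV label_preblock; have [[a ->]|[b ->]] := lrshiftP p.
  rewrite /= ltn_ord; apply/imsetP=> -[b _ /eqP].
  by rewrite eq_lrshift.
rewrite mem_imset ?inE ?label_block_right /= -?leqNgt ?leq_addr //; exact: rshift_inj.
Qed.

End Parts.
End BlockLabels.

(** * Transfer products and parks_star *)
Section StarMarks.
Variables (gT : finGroupType) (i j : nat).
Local Notation W := (wreath gT (i + j)).
Implicit Types (H : {group W}) (U : {set 'I_(i + j)}).

(** With [stable_eq_reps], this is the bijection between H-stable sets of points
    and sets of orbit representatives. *)
Lemma stable_of_reps H (T : {set 'I_(i + j)}) : T \subset orbit_reps H ->
  let U := [set p | orbit_rep H p \in T] in
  stable H U /\ orbit_reps H :&: U = T.
Proof.
move=> TR; split.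
  apply/stableP=> h p hH; rewrite !inE.
  have [rR pr] := orbit_repP H p.
  suff /eqP-> : orbit_rep H (h.2 p) == orbit_rep H p by [].
  rewrite orbit_rep_eq //; apply: point_orbit_trans pr _.
  by apply/point_orbitP; exists h.
apply/setP=> r; rewrite !inE; have [rR|rR] /= := boolP (r \in orbit_reps H).
  suff /eqP-> : orbit_rep H r == r by [].
  by rewrite orbit_rep_eq //; apply: orbit_refl.
by apply/esym/negbTE; apply: contra rR => /(subsetP TR).
Qed.

Lemma stable_eq_reps H U : stable H U ->
  U = [set p | orbit_rep H p \in orbit_reps H :&: U].
Proof.
move=> S; apply/setP=> p; have [rR pr] := orbit_repP H p.
by rewrite !inE rR -(stable_orbit S pr).
Qed.

(** In [mark_star] the terms are grouped by the values kappa and lambda of beta on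
    the two parts.  These always add up to beta H, and [choices_fact] counts the
    stable sets U that realise a given splitting. *)
Lemma parks_star_mark (x : burnside (wreath gT i)) (y : burnside (wreath gT j))
    (f : parks gT i) (g : parks gT j) :
  mark x = beta_star f -> mark y = beta_star g ->
  mark (star x y) = beta_star (parks_star f g).
Proof.
move=> Ex Ey; apply/ffunP=> C; rewrite -(class_repK C); move: (class_rep C) => {C} H.
have [g_ g_K] : exists g_ : {set 'I_(i + j)} -> W, forall U, #|U| = i -> front (g_ U) = U.
  exists (fun U => odflt 1%g [pick u | front u == U]) => U cU.
  have [u Eu] := front_surj gT cU.
  by case: pickP => [v /eqP//|none]; have := none u; rewrite Eu eqxx.
rewrite (mark_star _ _ _ g_K) Ex Ey ffunE [RHS]ffunE.
pose bL U := beta (class_of (left_part H (g_ U))).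
pose bR U := beta (class_of (right_part H (g_ U))).
pose S U := stable H U && (#|U| == i).
have bLE U : S U -> val (bL U) = lab_mset (label H) (orbit_reps H :&: U).
  case/andP=> stU /eqP cU.
  by rewrite /bL val_beta beta_left_part ?g_K.
have bRE U : S U -> val (bR U) = lab_mset (label H) (orbit_reps H :&: ~: U).
  case/andP=> stU /eqP cU.
  by rewrite /bR val_beta beta_right_part ?g_K.
rewrite (partition_big bL xpredT) //=; apply: eq_bigr => kappa _.
have bLRE U : S U -> (val (bL U) `+` val (bR U))%mset = val (beta (class_of H)).
  by move=> SU; rewrite bLE // bRE // lab_msetID val_beta.
rewrite (partition_big bR (fun lambda => (val kappa `+` val lambda)%mset
    == val (beta (class_of H)))) /=; last first.
  by move=> U /andP[SU /eqP<-]; rewrite bLRE.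
apply: eq_bigr => lambda /eqP Ekl.
rewrite (eq_bigr (fun=> f kappa * g lambda)); last first.
  by move=> U /andP[/andP[_ /eqP<-] /eqP<-]; rewrite !ffunE.
rewrite sumr_const -[LHS]mulr_natl; congr (_%:R * _).
have := @choices_fact _ _ (label H) (orbit_reps H) (val kappa) (val lambda).
rewrite -beta_groupE -(val_beta H) => /(_ Ekl) <-.
rewrite mulnK ?muln_gt0 ?parts_fact_gt0 //.
pose sat (T : {set 'I_(i + j)}) := [set p | orbit_rep H p \in T].
rewrite /choices; set A := [set T : {set _} | (T \subset _) && _].
have sat_inj : {in A &, injective sat}.
  move=> T1 T2; rewrite !inE => /andP[s1 _] /andP[s2 _] E.
  have [_ <-] := stable_of_reps s1; have [_ <-] := stable_of_reps s2.
  by rewrite -/(sat _) -/(sat _) E.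
rewrite -(card_in_imset sat_inj); apply: eq_card => U; rewrite [LHS]unfold_in /=.
apply/idP/imsetP => [/andP[/andP[SU /eqP EL] _]|[T]].
  exists (orbit_reps H :&: U); last by apply: stable_eq_reps; case/andP: SU.
  by rewrite inE subsetIl -bLE // EL eqxx.
rewrite inE => /andP[TR /eqP ET ->]; have [stU RU] := stable_of_reps TR.
have SU : S (sat T).
  rewrite /S stU -(label_mset_norm stU) RU ET.
  exact: valP kappa.
have EL : bL (sat T) = kappa by apply/val_inj; rewrite bLE // RU ET.
rewrite -/(S _) SU EL eqxx /=; apply/eqP/val_inj/msetP => k.
have := etrans (bLRE _ SU) (esym Ekl); rewrite EL => /msetP/(_ k).
by rewrite !msetE2 => /addnI.
Qed.

End StarMarks.

(** * Marks of powers *)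
Section PowerMarks.
Variables (gT : finGroupType) (n : nat) (X : gset gT).
Implicit Types (H : {group wreath gT n}).

Lemma power_actE (u : wreath gT n) (x : power_gset n X) p :
  gact (power_gset n X) u x (u.2 p) = gact X (u.1 (u.2 p)) (x p).
Proof. by rewrite ffunE permK. Qed.

(** A fixed point x satisfies x (h p) = h_(h p) x p, so it is determined by its
    values at orbit representatives r, which must be fixed by the isotropy
    groups H_rr and are otherwise arbitrary. *)
Lemma nfix_power H :
  nfix (power_gset n X) H =
  (\prod_(r in orbit_reps H) nfix X (isotropy_group H r))%N.
Proof.
pose R := orbit_reps H; pose Fx := 'Fix_(ract (power_gset n X))(H).
(* The option type supplies the value off the representatives, as X may be
   empty. *)
pose F (p : 'I_n) : {set option X} :=
  if p \in R then Some @: 'Fix_(ract X)(isotropy_group H p) else [set None].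
pose res (x : power_gset n X) : {ffun 'I_n -> option X} :=
  [ffun p => if p \in R then Some (x p) else None].
have card_F : #|(family F : simpl_pred _)| = (\prod_(r in R) nfix X (isotropy_group H r))%N.
  rewrite card_family foldrE big_image /= [RHS]big_mkcond /=; apply: eq_bigr => p _.
  rewrite /F; case: ifP => _; last by rewrite cards1.
  by rewrite card_imset //; apply: Some_inj.
rewrite -{}card_F /nfix -/Fx.
have res_inj : {in Fx &, injective res}.
  move=> x y /fixedP fx /fixedP fy /ffunP E; apply/ffunP=> p.
  have [rR /point_orbitP[h hH <-]] := orbit_repP H p.
  have := E (orbit_rep H p); rewrite !ffunE [_ \in R]rR => -[Er].
  by rewrite -{1}(fx h hH) -{1}(fy h hH) !power_actE Er.
rewrite -(card_in_imset res_inj); apply: eq_card => y.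
apply/imsetP/familyP => [[x /fixedP fx ->] p|yF].
  rewrite ffunE /F; case: ifP => pR; last by rewrite inE.
  apply/imsetP; exists (x p) => //; apply/fixedP=> c /isotropyP[h hH [hp <-]].
  by have := congr1 (fun z : power_gset n X => z (h.2 p)) (fx h hH);
    rewrite power_actE hp.
have ex_x p : exists xp : X, exists2 h, h \in H & exists2 z,
    h.2 (orbit_rep H p) = p /\ y (orbit_rep H p) = Some z & xp = gact X (h.1 p) z.
  have [rR /point_orbitP[h hH hp]] := orbit_repP H p.
  have := yF (orbit_rep H p); rewrite /F [_ \in R]rR => /imsetP[z _ Ez].
  by exists (gact X (h.1 p) z); exists h => //; exists z.
have [x xP] := fin_all_exists ex_x.
have fixz r z c : r \in R -> y r = Some z -> c \in isotropy H r -> gact X c z = z.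
  move=> rR Ez; have := yF r; rewrite /F rR Ez => /imsetP[z' /fixedP fz [->]].
  exact: fz.
exists [ffun p => x p]; last first.
  apply/ffunP=> p; rewrite !ffunE; case: ifP => pR; last first.
    by have := yF p; rewrite /F pR inE => /eqP.
  have repp : orbit_rep H p = p.
    by apply/eqP; rewrite orbit_rep_eq //; apply: orbit_refl.
  have [h hH [z [hp Ez] ->]] := xP p; rewrite repp in hp Ez.
  rewrite Ez (fixz p) //; apply/isotropyP; by exists h.
apply/fixedP=> h hH; apply/ffunP=> p; rewrite -[p](wreathKV h) power_actE.
move: (h^-1%g.2 p) => q; rewrite !ffunE.
have rq : orbit_rep H (h.2 q) = orbit_rep H q.
  have [rR qr] := orbit_repP H q; apply/eqP; rewrite orbit_rep_eq //.
  by apply: point_orbit_trans qr _; apply/point_orbitP; exists h.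
have [k kH [z [kq Ez] ->]] := xP q.
have [l lH [z' [lq Ez'] ->]] := xP (h.2 q).
move: Ez' lq; rewrite rq Ez => -[<-] lq; have [rR _] := orbit_repP H q.
set r := orbit_rep H q in kq lq rR Ez *.
(* The values at q and at h q were transported from r by k and by l; the
   discrepancy m fixes r, hence acts on z through the isotropy group. *)
pose m := (l^-1 * (h * k))%g; have mH : m \in H by rewrite !groupM ?groupV.
have mr : m.2 r = r by rewrite !wreathM2 kq -lq wreathK.
have lm : (l * m = h * k)%g by rewrite mulKVg.
move: m mH mr lm => m mH mr lm.
have mz : gact X (m.1 r) z = z.
  by apply: (fixz r) => //; apply/isotropyP; exists m.
rewrite -[in RHS]mz -!gactM; congr (gact X _ z).
have -> : (l.1 (h.2 q) * m.1 r)%g = (l * m)%g.1 (h.2 q).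
  by rewrite wreathM1 -lq permK.
by rewrite lm wreathM1 permK.
Qed.

Lemma mark_power : mark (gclass (power_gset n X)) =
  beta_star [ffun lambda : nparts gT n =>
    \prod_(k <- finsupp (val lambda)) mark (gclass X) k.1 ^+ (val lambda k)].
Proof.
apply/ffunP=> C; rewrite -(class_repK C); move: (class_rep C) => {C} H.
rewrite mark_gset nfix_power [RHS]ffunE [RHS]ffunE val_beta beta_groupE.
rewrite (big_morph Posz PoszM (erefl _)).
rewrite (eq_bigr (fun r => mark (gclass X) (label H r).1)) => [|r _]; last first.
  by rewrite mark_gset.
rewrite -big_enum -(big_map (label H) xpredT (fun k => mark (gclass X) k.1)).
by rewrite -(perm_big _ (perm_eq_seq_mset _)) big_mset.
Qed.

End PowerMarks.

Section CosetPower.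
Variables (gT : finGroupType) (m : nat) (K : {group gT}).
Hypothesis m_gt0 : (0 < m)%N.
Local Notation X := (coset_gset K).

(** The power of G / K is transitive with stabiliser K wr S_m, which acts
    transitively on the m points with isotropy group K. *)
Lemma gclass_coset_power : exists2 C : conj_class (wreath gT m),
  gclass (power_gset m X) = basis C &
  val (beta C) = [mset (class_of K, Sub m m_gt0 : {m : nat | (0 < m)%N})]%mset.
Proof.
have [p pK tr] := coset_gset_trans K.
pose x : power_gset m X := [ffun => p].
pose S := 'C[x | ract (power_gset m X)]%G.
have gK a : (gact X a p == p) = (a \in K) by rewrite -stabE pK.
have inS (u : wreath gT m) : (u \in S) = [forall i, u.1 i \in K].
  rewrite stabE; apply/eqP/forallP => [E i|uK].
    by have := congr1 (fun z : power_gset m X => z i) E; rewrite !ffunE -gK => ->.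
  by apply/ffunP=> i; rewrite !ffunE; apply/eqP; rewrite gK.
exists (class_of S).
  apply: gclass_trans => y.
  have [a aP] := fin_all_exists (fun i => tr (y i)).
  exists ([ffun i => a i], 1%g); apply/ffunP=> i.
  rewrite ffunE -[RHS]aP [x _]ffunE; congr (gact X _ p).
  by rewrite ffunE.
have lab i : label S i = (class_of K, Sub m m_gt0).
  congr (_, _).
    congr (class_of _); apply/val_inj/setP=> c /=; apply/isotropyP/idP => [[h]|cK].
      by rewrite inS => /forallP hK [_ <-].
    exists ([ffun => c], 1%g); last by rewrite ffunE perm1.
    by rewrite inS; apply/forallP=> j; rewrite ffunE.
  apply/val_inj => /=; rewrite -[RHS]card_ord -cardsT; apply: eq_card => j.
  rewrite inE; apply/point_orbitP; exists ([ffun => 1%g], tperm i j) => /=.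
    by rewrite inS; apply/forallP=> l; rewrite ffunE.
  exact: tpermL.
rewrite val_beta; apply: parts_eq => k; rewrite beta_labels.
set k0 := (_, _); rewrite msetnE [k == k0]eq_sym.
have -> : [set i | label S i == k] = if k0 == k then setT else set0.
  by apply/setP=> i; rewrite inE lab; case: ifP; rewrite !inE.
by case: eqP => [<-|_]; rewrite ?cardsT ?card_ord ?cards0 ?mul1n ?mul0n.
Qed.

End CosetPower.

(** * Elements whose mark is a function of beta *)
Section FromParks.
Variable gT : finGroupType.

Definition from_parks n (a : burnside (wreath gT n)) : Prop :=
  exists f : parks gT n, mark a = beta_star f.

Lemma beta_starB n : {morph @beta_star gT n : f g / f - g}.
Proof. by move=> f g; apply/ffunP=> C; rewrite !ffunE. Qed.

Lemma beta_starM n : {morph @beta_star gT n : f g / f * g}.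
Proof. by move=> f g; apply/ffunP=> C; rewrite !ffunE. Qed.

Lemma beta_star1 n : @beta_star gT n 1 = 1.
Proof. by apply/ffunP=> C; rewrite !ffunE. Qed.

Lemma from_parksB n (a b : burnside (wreath gT n)) :
  from_parks a -> from_parks b -> from_parks (a - b).
Proof. by move=> [f Ef] [g Eg]; exists (f - g); rewrite markB Ef Eg beta_starB. Qed.

Lemma from_parksM n (a b : burnside (wreath gT n)) :
  from_parks a -> from_parks b -> from_parks (a * b).
Proof. by move=> [f Ef] [g Eg]; exists (f * g); rewrite [LHS]markM Ef Eg beta_starM. Qed.

Lemma from_parks1 n : from_parks (1 : burnside (wreath gT n)).
Proof. by exists 1; rewrite [LHS]mark1 beta_star1. Qed.

Lemma from_parks0 n : from_parks (0 : burnside (wreath gT n)).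
Proof. by rewrite -(subrr 1); apply: from_parksB; apply: from_parks1. Qed.

Lemma from_parksD n (a b : burnside (wreath gT n)) :
  from_parks a -> from_parks b -> from_parks (a + b).
Proof.
move=> pa pb; rewrite -[b]opprK; apply: from_parksB => //.
by rewrite -sub0r; apply: from_parksB => //; apply: from_parks0.
Qed.

Lemma from_parks_sum n (I : Type) (r : seq I) (Q : pred I)
    (F : I -> burnside (wreath gT n)) :
  (forall i, Q i -> from_parks (F i)) -> from_parks (\sum_(i <- r | Q i) F i).
Proof.
by move=> FQ; apply: big_ind => //; [exact: from_parks0 | exact: from_parksD].
Qed.

Lemma from_parksMz n (a : burnside (wreath gT n)) (m : int) :
  from_parks a -> from_parks (a *~ m).
Proof.
move=> pa; have nat_case k : from_parks (a *+ k).
  elim: k => [|k IH]; first exact: from_parks0.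
  by rewrite mulrS; apply: from_parksD.
case: m => k; first exact: nat_case.
by rewrite NegzE mulrNz -sub0r; apply: from_parksB; [exact: from_parks0 | exact: nat_case].
Qed.

Lemma from_parks_star i j (a : burnside (wreath gT i)) (b : burnside (wreath gT j)) :
  from_parks a -> from_parks b -> from_parks (star a b).
Proof.
by move=> [f Ef] [g Eg]; exists (parks_star f g); apply: parks_star_mark.
Qed.

Lemma from_parks_power n (X : gset gT) : from_parks (gclass (power_gset n X)).
Proof. by eexists; apply: mark_power. Qed.

Lemma from_parks_cast m n (e : m = n) (a : burnside (wreath gT m)) :
  from_parks a -> from_parks (burnside_cast e a).
Proof. by case: n / e. Qed.

(** The term i = 0 of the addition formula; Q abstracts n |-> P n x so that the
    type of the second factor can follow the equation. *)
Lemma cast_star1x m n (e : 0 + m = n) (Q : forall k, burnside (wreath gT k)) :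
  burnside_cast e (@star gT 0 m 1 (Q m)) = Q n.
Proof. by case: n / e; apply: star1x. Qed.

Definition empty_gset : gset gT :=
  @GSet gT void (fun _ x => x) (fun _ => erefl) (fun _ _ _ => erefl).

Lemma gclass_empty : gclass empty_gset = 0.
Proof.
apply/ffunP=> C; rewrite !ffunE; apply/eqP; rewrite eqz_nat cards_eq0.
apply/eqP/setP=> O; rewrite !inE; apply/negP => /andP[_ /exists_inP[[]]].
Qed.

Section TotalPower.
Variable P : forall n, burnside gT -> burnside (wreath gT n).
Hypothesis HP : is_total_power P.

(** The formula for P n (x - x) = P n 0 expresses P n (- x), its term i = 0,
    through P i x and the P (n - i) (- x) with i > 0. *)
Lemma total_powerN x :
  (forall n, from_parks (P n x)) -> forall n, from_parks (P n (- x)).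
Proof.
move=> Px n; have [m] := ubnP n; elim: m => // m IH in n *; rewrite ltnS => nm.
have := power_add HP n x (- x); rewrite subrr -gclass_empty (power_gclass HP).
rewrite big_ord_recl (power_zero HP).
rewrite (@cast_star1x (n - @ord0 n)%N n _ (fun k => P k (- x))) => /eqP.
rewrite -subr_eq => /eqP <-; apply: from_parksB.
  exact: from_parks_power.
apply: from_parks_sum => i _; apply/from_parks_cast/from_parks_star; first exact: Px.
apply: IH; rewrite lift0; case: n i nm => [[]//|n] i nm.
by rewrite subSS (leq_ltn_trans (leq_subr _ _)).
Qed.

Lemma from_parks_total_power n x : from_parks (P n x).
Proof.
pose E y := forall n, from_parks (P n y).
have ED y z : E y -> E z -> E (y + z).
  move=> Ey Ez k; rewrite (power_add HP); apply: from_parks_sum => i _.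
  by apply/from_parks_cast/from_parks_star; [apply: Ey | apply: Ez].
have E0 : E 0 by move=> k; rewrite -gclass_empty (power_gclass HP); apply: from_parks_power.
suff: E x by [].
rewrite [x]basis_expand; apply: big_ind => // C _.
have EC : E (basis C).
  by move=> k; rewrite -gclass_transitive (power_gclass HP); apply: from_parks_power.
have nat_case k : E (basis C *+ k).
  by elim: k => [|k IH] //; rewrite mulrS; apply: ED.
case: (x C) => k; first exact: nat_case.
by rewrite NegzE mulrNz => l; apply: total_powerN; apply: nat_case.
Qed.

End TotalPower.

(** * Star monomials *)
Inductive star_monomial : forall n, burnside (wreath gT n) -> Prop :=
| star_monomial1 : @star_monomial 0 1
| star_monomialM i m (a : burnside (wreath gT i)) (K : {group gT}) :
    star_monomial a ->
    star_monomial (star a (gclass (power_gset m (coset_gset K)))).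

Lemma from_parks_monomial n (a : burnside (wreath gT n)) :
  star_monomial a -> from_parks a.
Proof.
elim=> [|i m b K _ pb]; first exact: from_parks1.
by apply: from_parks_star => //; apply: from_parks_power.
Qed.

(** The monomial that has one factor P_m [G / K] for each part ([K], m): it is a
    basis element by [star_basis], and beta of a block subgroup is the sum of the
    values of beta. *)
Lemma seq_monomial (s : seq (conj_class gT * {m : nat | (0 < m)%N})) n :
  n = (\sum_(k <- s) val k.2)%N ->
  exists2 C : conj_class (wreath gT n), star_monomial (basis C) &
    val (beta C) = seq_mset s.
Proof.
elim: s n => [|[D [m m0]] s IH] n; [rewrite big_nil | rewrite big_cons addnC] => ->.
  exists (class_of [set: wreath gT 0]%G); first by rewrite -burnside1; apply: star_monomial1.
  apply/msetP=> k; rewrite [RHS]mset_seqE.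
  have := parts_norm_ge (val (beta (class_of [set: wreath gT 0]%G))) k.
  rewrite (eqP (valP (beta _))) leqn0 muln_eq0 => /orP[/eqP E0|]; first exact: E0.
  by rewrite eqn0Ngt (valP k.2).
have [C mC bC] := IH _ erefl.
have [E gE bE] := gclass_coset_power (class_rep D) m0.
exists (class_of (block_group (class_rep C) (class_rep E))).
  by rewrite -star_basis -gE; apply: star_monomialM.
rewrite val_beta beta_block_group -!val_beta !class_repK bC bE class_repK.
by rewrite msetDC -mset_cons.
Qed.

Lemma exists_monomial n (lambda : nparts gT n) :
  exists2 C : conj_class (wreath gT n), star_monomial (basis C) & beta C = lambda.
Proof.
have [|C mC bC] := @seq_monomial (enum_mset (val lambda)) n.
  by rewrite sum_mset; apply/esym/eqP; rewrite -[X in _ == X](eqP (valP lambda)).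
by exists C => //; apply/val_inj; rewrite bC seq_mset_id.
Qed.

Lemma beta_star_inj n : injective (@beta_star gT n).
Proof.
move=> f g /ffunP E; apply/ffunP=> lambda.
by have [C _ <-] := exists_monomial lambda; have := E C; rewrite !ffunE.
Qed.

(** The mark of the orbit is nonzero at its own stabiliser, hence at every H with
    the same value of beta. *)
Lemma sub_monomial n (C : conj_class (wreath gT n)) (H : {group wreath gT n}) :
  star_monomial (basis C) -> beta (class_of H) = beta C ->
  exists a, H \subset class_rep C :^ a.
Proof.
move=> /from_parks_monomial[f Ef] bH; apply: mark_basis_neq0.
by have := mark_basis_diag C; rewrite Ef !ffunE bH.
Qed.

(** Removing the star monomials from a leaves an element b whose mark still
    depends on beta only.  Let C be maximal among the classes in its support;
    then b has nonzero mark at C, hence at the star monomial E with beta E =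
    beta C.  So E is subconjugate to some D in the support, while C is
    subconjugate to E; by maximality C = E, which had been removed. *)
Lemma from_parks_support n (a : burnside (wreath gT n)) C :
  from_parks a -> a C != 0 -> star_monomial (basis C).
Proof.
move=> pa aC; pose Q (D : conj_class (wreath gT n)) := `[< star_monomial (basis D) >].
suff: Q C by move/asboolP.
apply: contraT => QC.
pose b := a - \sum_(D | Q D) basis D *~ a D.
have pb : from_parks b.
  apply: from_parksB => //; apply: from_parks_sum => D /asboolP mD.
  by apply/from_parksMz/from_parks_monomial.
have bE D : b D = if Q D then 0 else a D.
  rewrite /b {1}[a]basis_expand (bigID Q) /= [X in X - _]addrC addrK.
  rewrite sum_ffunE big_mkcond /= (bigD1 D) //= big1 => [|D' DD'].
    by rewrite addr0; case: (Q D) => //=; rewrite burnside_mulrz ffunE eqxx mul1r.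
  by case: (Q D') => //=; rewrite burnside_mulrz ffunE (negbTE DD') mul0r.
have bC : b C != 0 by rewrite bE (negbTE QC).
case: (arg_maxnP (fun D => #|class_rep D|) (P := fun D => b D != 0) bC).
move=> {aC QC bC} {}C bC maxC.
have [f Ef] := pb; have [E mE bEC] := exists_monomial (beta C).
have [c CE] : exists c, class_rep C \subset class_rep E :^ c.
  by apply: sub_monomial; rewrite // class_repK bEC.
have mbC : mark b C != 0.
  rewrite mark_expand (bigD1 C) //= big1 ?addr0 => [|D DC].
    by rewrite mulf_neq0 // mark_basis_diag.
  have [->|bD] := eqVneq (b D) 0; first by rewrite mul0r.
  apply/eqP; rewrite mulf_eq0; apply/orP; right; apply: contraNT DC.
  rewrite -{1}[C]class_repK => /mark_basis_neq0[x CD].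
  by rewrite (class_rep_sub CD) //; apply: maxC.
have : mark b E != 0 by move: mbC; rewrite Ef !ffunE bEC.
rewrite mark_expand => mbE.
have [D] : exists D, b D * mark (basis D) E != 0.
  apply/existsP; apply: contraNT mbE; rewrite negb_exists => /forallP z.
  by apply/eqP; apply: big1 => D _; apply/eqP; have := z D; rewrite negbK.
rewrite mulf_eq0 negb_or -{1}[E]class_repK => /andP[bD /mark_basis_neq0[x ED]].
have leCE : (#|class_rep C| <= #|class_rep E|)%N.
  by rewrite -(cardJg (class_rep E) c) subset_leq_card.
have leEC : (#|class_rep E| <= #|class_rep C|)%N.
  apply: leq_trans (maxC D bD); by rewrite -(cardJg (class_rep D) x) subset_leq_card.
have QC : Q C by apply/asboolP; rewrite (class_rep_sub CE leEC).
by move: bC; rewrite bE QC eqxx.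
Qed.

End FromParks.

(** * A point with prescribed isotropy *)
Section StabiliserWithSameLabels.
Variables (gT : finGroupType) (n : nat) (H : {group wreath gT n}).

(** Any H in G wr S_n acts on G x [n] and commutes with the left translations by
    G; the subsets of G x [n] form a G-set that contains the orbits of this
    action, which are used as a universal source of H-fixed points. *)
Definition translate_act (a : gT) (A : {set gT * 'I_n}) : {set gT * 'I_n} :=
  [set ((a * q.1)%g, q.2) | q in A].

Lemma translate_act1 A : translate_act 1%g A = A.
Proof. by rewrite -[RHS]imset_id; apply: eq_imset => -[c i]; rewrite /= mul1g. Qed.

Lemma translate_actM a b A :
  translate_act (a * b)%g A = translate_act a (translate_act b A).
Proof.
by rewrite /translate_act -imset_comp; apply: eq_imset => -[c i]; rewrite /= mulgA.
Qed.

Definition translate_gset : gset gT := GSet translate_act1 translate_actM.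

(** The p-th coordinate is the H-orbit of (1, p). *)
Definition generic_point : power_gset n translate_gset :=
  [ffun p => [set (h.1 p, (h.2^-1)%g p) | h : wreath gT n in H]].

(** The stabiliser consists of the elements that agree with some element of H at
    each single point, which is enough to have the orbits and the isotropy groups
    of H. *)
Lemma stab_generic_pointP (u : wreath gT n) :
  reflect (forall p, exists2 h : wreath gT n, h \in H &
             u.1 p = h.1 p /\ (u.2^-1)%g p = (h.2^-1)%g p)
          (u \in 'C[generic_point | ract (power_gset n translate_gset)]).
Proof.
have actE v p : gact (power_gset n translate_gset) v generic_point p =
    [set ((v * h)%g.1 p, ((v * h)%g.2^-1)%g p) | h : wreath gT n in H].
  rewrite ffunE /= /translate_act ffunE -imset_comp; apply: eq_imset => h /=.
  by rewrite ffunE invMg permM.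
rewrite stabE; apply: (iffP eqP) => [E p|uH].
  have := congr1 (fun x : power_gset n translate_gset => x p) E.
  rewrite actE ffunE => /setP/(_ (u.1 p, (u.2^-1)%g p)).
  have -> : (u.1 p, (u.2^-1)%g p) \in
      [set ((u * h)%g.1 p, ((u * h)%g.2^-1)%g p) | h : wreath gT n in H].
    by apply/imsetP; exists 1%g; rewrite ?group1 ?mulg1.
  by move/esym/imsetP=> [h hH [E1 E2]]; exists h.
apply/ffunP=> p; rewrite actE ffunE; have [k kH [E1 E2]] := uH p.
have uE h : ((u * h)%g.1 p, ((u * h)%g.2^-1)%g p) = ((k * h)%g.1 p, ((k * h)%g.2^-1)%g p).
  by rewrite !wreathM1 E1 E2 /= !invMg !permM E2.
apply/setP=> q; apply/imsetP/imsetP => [[h hH ->]|[h hH ->]].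
  by exists (k * h)%g; rewrite ?groupM // uE.
exists (k^-1 * h)%g; first by rewrite groupM ?groupV.
by rewrite uE mulKVg.
Qed.

Local Notation S := 'C[generic_point | ract (power_gset n translate_gset)]%G.

Lemma sub_stab_generic_point : H \subset S.
Proof. by apply/subsetP=> h hH; apply/stab_generic_pointP => p; exists h. Qed.

Lemma beta_stab_generic_point : beta_group S = beta_group H.
Proof.
apply: beta_group_label => p; congr (_, _).
  congr (class_of _); apply/val_inj/setP=> c /=.
  apply/isotropyP/isotropyP => [[u uS [up <-]]|[h hH hp]]; last first.
    by exists h => //; apply: (subsetP sub_stab_generic_point).
  have [h hH [E1 E2]] := stab_generic_pointP _ uS p.
  exists h => //; split=> //; apply: (@perm_inj _ (h.2^-1)%g).
  by rewrite -E2 permK -{2}up permK.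
apply/val_inj => /=; apply: eq_card => q.
apply/point_orbitP/point_orbitP => [[u uS up]|[h hH hp]]; last first.
  by exists h => //; apply: (subsetP sub_stab_generic_point).
have [h hH [_ E2]] := stab_generic_pointP _ uS q.
exists h => //; apply: (@perm_inj _ (h.2^-1)%g).
by rewrite -E2 permK -up permK.
Qed.

End StabiliserWithSameLabels.

(** * The ring of total powers and its marks *)
Section MarksOfAring.
Variables (gT : finGroupType).
Variable P : forall n : nat, burnside gT -> burnside (wreath gT n).
Hypothesis HP : is_total_power P.

(** The stabiliser S of the generic point contains H = class_rep C and has the
    same beta, so it is subconjugate to H by [sub_monomial]; hence its orbit in
    the power of the translation set has class C. *)
Lemma monomial_in_basis n (C : conj_class (wreath gT n)) :
  star_monomial (basis C) -> C \in aring_basis P n.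
Proof.
move=> mC; apply/bigcapP => T /asboolP spanT.
pose H := class_rep C; pose x := generic_point H.
pose X := power_gset n (translate_gset gT n); pose S := 'C[x | ract X]%G.
have [a Sa] : exists a, S \subset class_rep C :^ a.
  apply: sub_monomial => //; apply/val_inj.
  by rewrite val_beta beta_stab_generic_point -val_beta class_repK.
have CS : class_of S = C.
  rewrite -[RHS]class_repK; apply/esym/eqP/class_ofP; exists a; apply/eqP.
  by rewrite eqEcard Sa cardJg subset_leq_card // sub_stab_generic_point.
have /forallP/(_ C)/implyP := spanT (gclass (translate_gset gT n)).
rewrite (power_gclass HP) ffunE; apply.
rewrite eqz_nat -lt0n; apply/card_gt0P; exists (orbit (ract X) [set: wreath gT n] x).
rewrite inE imset_f ?inE //=; apply/exists_inP; exists x; first exact: orbit_refl.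
by apply/eqP.
Qed.

(** The star monomials form a set of basis elements whose span contains the image
    of P n, and each of them occurs in that image, so this set is the least one. *)
Lemma aring_from_parks n (a : burnside (wreath gT n)) :
  a \in aring_pred P n <-> from_parks a.
Proof.
split=> [/forallP/= aB|pa]; last first.
  apply/forallP=> C; apply/implyP=> /(from_parks_support pa).
  exact: monomial_in_basis.
rewrite [a]basis_expand; apply: from_parks_sum => C _.
have [->|aC] := eqVneq (a C) 0; first by rewrite mulr0z; apply: from_parks0.
apply/from_parksMz/from_parks_monomial.
have := aB C; rewrite aC /= => /bigcapP/(_ [set D | `[< star_monomial (basis D) >]]).
rewrite inE => H; apply/asboolP/H/asboolP => x.
apply/forallP=> D; apply/implyP=> PD; rewrite inE; apply/asboolP.
by apply: from_parks_support PD; apply: from_parks_total_power.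
Qed.

Variable chi : forall n : nat, aring P n -> parks gT n.
Hypothesis Hchi : is_parks_hom chi.

(** The statement of [mark_aring] as a predicate on the whole Burnside ring, so
    that sums and star products are formed there. *)
Definition compatible n (b : burnside (wreath gT n)) : Prop :=
  exists2 a : aring P n, val a = b & mark b = beta_star (chi a).

Lemma chiB n (a b : aring P n) : chi (a - b) = chi a - chi b.
Proof. exact: (parks_additive Hchi). Qed.

Lemma compatibleB n (a b : burnside (wreath gT n)) :
  compatible a -> compatible b -> compatible (a - b).
Proof.
move=> [a' Ea Ma] [b' Eb Mb]; exists (a' - b'); first by rewrite -Ea -Eb.
by rewrite markB chiB beta_starB Ma Mb.
Qed.

Lemma compatible_monomial n (a : burnside (wreath gT n)) :
  star_monomial a -> compatible a.
Proof.
elim=> [|i m b K mb [b' Eb Mb]].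
  have in1 : (1 : burnside (wreath gT 0)) \in aring_pred P 0.
    by apply/aring_from_parks/from_parks1.
  exists (Sub 1 in1); first by rewrite SubK.
  by rewrite (parks_unit Hchi) ?SubK // beta_star1; apply: mark1.
set p := gclass _.
have inp : p \in aring_pred P m.
  by apply/aring_from_parks/from_parks_power.
have ins : star b p \in aring_pred P (i + m)%N.
  apply/aring_from_parks/from_parks_star; last exact: from_parks_power.
  exact: from_parks_monomial.
exists (Sub (star b p) ins); first by rewrite SubK.
rewrite (parks_mul Hchi (a := b') (b := Sub p inp)) ?SubK ?Eb //.
apply: parks_star_mark => //; rewrite /p mark_power; congr beta_star.
apply/ffunP=> lambda; rewrite ffunE (parks_power Hchi (x := gclass (coset_gset K))) //.
by rewrite SubK (power_gclass HP).
Qed.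

Lemma mark_aring n (a : aring P n) : mark (val a) = beta_star (chi a).
Proof.
suff: compatible (val a) by case=> a' /val_inj ->.
have c0 : compatible (0 : burnside (wreath gT n)).
  exists 0; first by [].
  have -> : chi (0 : aring P n) = 0 by rewrite -(subrr 0) chiB subrr.
  by rewrite raddf0; apply/ffunP=> C; rewrite !ffunE.
have cN (b : burnside (wreath gT n)) : compatible b -> compatible (- b).
  by move=> cb; rewrite -sub0r; exact: compatibleB.
have cD (b c : burnside (wreath gT n)) : compatible b -> compatible c -> compatible (b + c).
  by move=> cb /cN cc; rewrite -[c]opprK; exact: compatibleB cb cc.
rewrite [val a]basis_expand; apply: big_ind => // C _.
have [->|aC] := eqVneq (val a C) 0; first by rewrite mulr0z.
have cC : compatible (basis C).
  apply: compatible_monomial; apply: from_parks_support aC.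
  exact/aring_from_parks/valP.
have nat_case k : compatible (basis C *+ k).
  by elim: k => [|k IH] //; rewrite mulrS; apply: cD.
case: (val a C) => k; first exact: nat_case.
by rewrite NegzE mulrNz; apply/cN/nat_case.
Qed.

End MarksOfAring.

(** * The pullback square *)
Theorem corollary13p6 (gT : finGroupType)
    (P : forall n : nat, burnside gT -> burnside (wreath gT n))
    (HP : is_total_power P)
    (chi : forall n : nat, aring P n -> parks gT n)
    (Hchi : is_parks_hom chi)
    (n : nat) :
  exists HA : GRing.subring_closed (aring_pred P n),
    @is_pullback
      (subring_of HA) (burnside (wreath gT n))
      (parks gT n) (marks (wreath gT n))
      (fun a => val a) (fun a => chi n a)
      (@mark (wreath gT n)) (@beta_star gT n).
Proof.
have memP := aring_from_parks HP.
have HA : GRing.subring_closed (aring_pred P n).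
  split=> [|a b /memP pa /memP pb|a b /memP pa /memP pb]; apply/memP.
  - exact: from_parks1.
  - exact: from_parksB.
  - exact: from_parksM.
exists HA; pose A := subring_of HA.
have comm (a : A) : mark (val a) = beta_star (chi n a).
  exact: (mark_aring HP Hchi a).
split.
- by split=> [a b|]; [exact: raddfB | split=> [|a b]; [exact: rmorph1 | exact: rmorphM]].
(* As beta_star is injective, chi inherits all ring identities from mark. *)
- split=> [a b|].
    by apply: beta_star_inj; rewrite beta_starB -!comm; apply: markB.
  split=> [|a b]; apply: beta_star_inj; rewrite -comm.
    by rewrite beta_star1; apply: mark1.
  by rewrite beta_starM -!comm; exact: (markM (val a) (val b)).
- by split=> [a b|]; [exact: raddfB | split=> [|a b]; [exact: mark1 | exact: markM]].
- by split=> [f g|]; [exact: beta_starB | split=> [|f g]; [exact: beta_star1 | exact: beta_starM]].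
- exact: comm.
move=> T u v [uB [u1 uM]] [vB [v1 vM]] uv.
have uA t : u t \in aring_pred P n by apply/memP; exists (v t); exact: uv.
pose w t : A := exist _ (u t) (uA t).
exists w => [|w' _ w'u _ t]; last exact/val_inj/w'u.
split=> [|//|t]; last by apply: beta_star_inj; rewrite -uv -comm.
split=> [s t|]; first by apply/val_inj; rewrite raddfB /= uB.
split=> [|s t]; apply/val_inj; first by rewrite /= u1.
by rewrite /= uM.
Qed.
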